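(* Let $\mathsf T$ be any subset of $L_{d,n}$, let $m\ge0$ be an integer, and let $\hat\theta^{OL}$ be the OLRADRE predictor of degree $m$ with truncation parameter $\lambda$. There exist an absolute constant $C$ and a number $C_{m,d}>1$ depending only on $m$ and $d$ such that for $\lambda\ge C(\sigma\sqrt{\log N}\vee\|\theta^*\|_\infty)$ and any non-anticipating ordering $\rho$ of $L_{d,n}$, $$\frac1{|\mathsf T|}\mathbb E\|\hat\theta^{OL}_{\mathsf T}-\theta^*_{\mathsf T}\|^2\le\inf_{P\in\mathcal P_{\mathrm{all},\mathsf T},\,\theta\in\Theta_P}\Big(\frac1{|\mathsf T|}\|\theta^*_{\mathsf T}-\theta\|^2+C_{m,d}\lambda_{m,*}^2\frac{|P|}{|\mathsf T|}(\log en)^d\log(2^dN)\Big)+\frac{\sigma^2+\lambda^2}{|\mathsf T|^2},$$ where $\lambda_{m,*}=\lambda+s_{m,\infty}(\theta)$.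
   Context: Model: $y=\theta^*+\sigma\epsilon\in\mathbb R^{L_{d,n}}$ with $\sigma>0$ and $(\epsilon_s)$ independent, mean zero, with $\max(\mathbb P[\epsilon_s\ge x],\mathbb P[\epsilon_s\le -x])\le 2e^{-x^2/2}$ for $x\ge0$. $L_{d,n}=[n]^d$, $n=2^k$, $N=n^d$. An ordering is a (possibly random) bijection $\rho:[N]\to L_{d,n}$, $\rho[a:b]=\{\rho(a),\dots,\rho(b)\}$; it is non-anticipating if for every $t$, conditionally on $(\rho[1:t],y_{\rho[1:t-1]})$, on $\{\rho(t)=s\}$ the variable $\epsilon_{\rho(t)}$ is distributed as $\epsilon_s$. A dyadic interval is $((a-1)2^s,a2^s]\cap\mathbb Z$ with integers $0\le s\le k$, $1\le a\le2^{k-s}$; a dyadic rectangle is a product of $d$ dyadic intervals; $\mathcal S$ is the set of all dyadic rectangles. Basis: $\mathcal F=\{u\mapsto (u/n)^{\mathbf m}=\prod_{i\in[d]}(u_i/n)^{m_i}:\ \mathbf m\in\mathbb Z_{\ge0}^d,\ |\mathbf m|=\sum_i m_i\le m\}$, and $x_u=(f(u))_{f\in\mathcal F}$. OLRADRE of degree $m$ is the following algorithm with $\lambda>1$, $\alpha=1/(8\lambda^2)$, $T_\lambda(x)=\min\{\max\{x,-\lambda\},\lambda\}$: for $\rho(t)\in S$, with $U=\rho[1:t-1]\cap S$, expert $S$ predicts $\hat y^{(S)}_{\rho(t)}=\hat\beta\cdot x_{\rho(t)}$, $\hat\beta=\big(I+\sum_{u\in U\cup\{\rho(t)\}}x_ux_u^T\big)^{-1}\sum_{u\in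 U}y_ux_u$; $w_{S,1}=1/|\mathcal S|$; for $t=1,\dots,N$: $A_t=\{S\in\mathcal S:\rho(t)\in S,\ \rho(t')\in S\text{ for some }t'<t\}$ for $t>1$, $A_1=\{S:\rho(1)\in S\}$; predict $\hat\theta^{OL}_{\rho(t)}=\sum_{S\in A_t}\hat w_{S,t}T_\lambda(\hat y^{(S)}_{\rho(t)})$, $\hat w_{S,t}=w_{S,t}/\sum_{S'\in A_t}w_{S',t}$; then $w_{S,t+1}=w_{S,t}$ for $S\notin A_t$ and $w_{S,t+1}=\frac{w_{S,t}e^{-\alpha\ell_{S,t}}}{\sum_{S'\in A_t}w_{S',t}e^{-\alpha\ell_{S',t}}}\sum_{S'\in A_t}w_{S',t}$ for $S\in A_t$, with $\ell_{S,t}=(T_\lambda(y_{\rho(t)})-T_\lambda(\hat y^{(S)}_{\rho(t)}))^2$. A rectangle is $\prod_{i=1}^d[a_i,b_i]\cap\mathbb Z^d$ with $1\le a_i\le b_i\le n$; $\mathcal P_{\mathrm{all},\mathsf T}$ is the set of all partitions of $\mathsf T$ into rectangles; for a partition $P$ of $\mathsf T$, $\Theta_P=\{\theta\in\mathbb R^{\mathsf T}:\ \text{for each }S\in P,\ \theta_S\text{ is the restriction to }S\text{ of a polynomial of degree}\le m\}$. For $\theta\in\Theta_P$ written as $\theta_S(u)=\sum_{|\mathbf m|\le m}\beta_{\mathbf m,S}u^{\mathbf m}$ on each $S\in P$, $s_{m,\infty}(\theta)=\max_{S\in P,|\mathbf m|\le m}n^{|\mathbf m|}|\beta_{\mathbf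 m,S}|$ (the bound holds for the given choice of coefficients). *)

(* Defs.v *)
From HB Require Import structures.
From mathcomp Require Import all_boot all_order all_algebra.
From mathcomp Require Import all_classical all_reals all_analysis.
Set Implicit Arguments. Unset Strict Implicit. Unset Printing Implicit Defensive.
Import Order.TTheory GRing.Theory Num.Theory.
Local Open Scope ring_scope.

(* The lattice L_{d,n} = [n]^d.  A point u has i-th coordinate (u i).+1 in {1..n}. *)
Definition lattice (d n : nat) := {ffun 'I_d -> 'I_n}.
Definition lcoord (d n : nat) (u : lattice d n) (i : 'I_d) : nat := (u i).+1.

Definition dyadic_rects (d k : nat) : {set {set lattice d (2 ^ k)}} :=
  [set S : {set lattice d (2 ^ k)} |
     [exists s : {ffun 'I_d -> 'I_k.+1},
      exists a : {ffun 'I_d -> 'I_(2 ^ k).+1},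
        [forall i, (1 <= a i)%N && (a i <= 2 ^ (k - s i))%N] &&
        (S == [set u | [forall i, ((a i).-1 * 2 ^ s i < lcoord u i)%N
                                  && (lcoord u i <= a i * 2 ^ s i)%N]])]].

Definition is_rect (d n : nat) (S : {set lattice d n}) : bool :=
  [exists a : {ffun 'I_d -> 'I_n}, exists b : {ffun 'I_d -> 'I_n},
     [forall i, (a i <= b i)%N] &&
     (S == [set u : lattice d n | [forall i, (a i <= u i)%N && (u i <= b i)%N]])].

Definition rect_partition (d n : nat) (P : {set {set lattice d n}})
  (T : {set lattice d n}) : bool :=
  finset.partition P T && [forall S in P, is_rect S].

Definition monos (d m : nat) : {set {ffun 'I_d -> 'I_m.+1}} :=
  [set mm : {ffun 'I_d -> 'I_m.+1} | (\sum_(i < d) (mm i : nat) <= m)%N].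

Definition absmono (d m : nat) (mm : {ffun 'I_d -> 'I_m.+1}) : nat :=
  (\sum_(i < d) (mm i : nat))%N.

Section Algo.
Variables (R : realType) (d k m : nat).
Local Notation n := (2 ^ k)%N.
Local Notation L := (lattice d n).
Local Notation p := #|monos d m|.

Definition feat (u : L) : 'cV[R]_p :=
  \col_(j < p) \prod_(i < d) ((lcoord u i)%:R / n%:R) ^+ (enum_val j : {ffun _ -> _}) i.

Variables (lam : R) (y : L -> R).

Definition trunc (x : R) : R := Num.min (Num.max x (- lam)) lam.
Definition alpha : R := (8 * lam ^+ 2)^-1.

(* expert S's (ridge) prediction at point v when h is the list of past points *)
Definition expert_pred (h : seq L) (S : {set L}) (v : L) : R :=
  let U := [set u in h] :&: S in
  let G := 1%:M + \sum_(u in v |: U) (feat u *m (feat u)^T) in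
  let b := invmx G *m \sum_(u in U) (y u *: feat u) in
  ((feat v)^T *m b) 0 0.

Definition active (h : seq L) (v : L) : {set {set L}} :=
  [set S in dyadic_rects d k | (v \in S) && (nilp h || has (fun u => u \in S) h)].

Definition w0 : {set L} -> R := fun _ => (#|dyadic_rects d k|%:R)^-1.

Definition loss (h : seq L) (S : {set L}) (v : L) : R :=
  (trunc (y v) - trunc (expert_pred h S v)) ^+ 2.

Definition update (w : {set L} -> R) (h : seq L) (v : L) : {set L} -> R :=
  let A := active h v in
  let Z := \sum_(S in A) w S in
  let Ze := \sum_(S in A) w S * expR (- alpha * loss h S v) in
  fun S => if S \in A then w S * expR (- alpha * loss h S v) / Ze * Z else w S.

Definition weights (h : seq L) : {set L} -> R :=
  (foldl (fun st v => (update st.1 st.2 v, rcons st.2 v)) (w0, [::]) h).1.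

Definition olr_pred (h : seq L) (v : L) : R :=
  let A := active h v in
  let w := weights h in
  \sum_(S in A) (w S / \sum_(S' in A) w S') * trunc (expert_pred h S v).

End Algo.

(* OLRADRE estimate theta^OL_u for ordering r : [N] -> L and data y:
   the prediction issued at the time t with r t = u. *)
Definition olradre (R : realType) (d k m : nat) (lam : R)
  (r : 'I_((2 ^ k) ^ d) -> lattice d (2 ^ k)) (y : lattice d (2 ^ k) -> R)
  (u : lattice d (2 ^ k)) : R :=
  let s := [seq r i | i <- enum 'I_((2 ^ k) ^ d)] in
  olr_pred m lam y (take (index u s) s) u.

Definition s_m_inf (R : realType) (d n m : nat) (P : {set {set lattice d n}})
  (beta : {set lattice d n} -> {ffun 'I_d -> 'I_m.+1} -> R) : R :=
  \big[Num.max/0]_(S in P) \big[Num.max/0]_(mm in monos d m)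
     (n%:R ^+ absmono mm * `|beta S mm|).

Definition sup_norm (R : realType) (d n : nat) (th : lattice d n -> R) : R :=
  \big[Num.max/0]_(u : lattice d n) `|th u|.

(* Main.v *)
Require Import Defs.
From HB Require Import structures.
From mathcomp Require Import all_boot all_order all_algebra.
From mathcomp Require Import all_classical all_reals all_analysis.
From mathcomp Require Import measurable_realfun.
From mathcomp Require Import perm ring lra zify.
Set Implicit Arguments. Unset Strict Implicit. Unset Printing Implicit Defensive.
Import Order.TTheory GRing.Theory Num.Theory.
Import numFieldNormedType.Exports.
Local Open Scope ring_scope.

(** Every rectangle splits into at most (2(k+1))^d maximal dyadic rectangles.  On
    one of them the aggregated forecaster loses at most 8 lam^2 ln |S| against the
    expert attached to it, because z |-> exp(- alpha (y - z)^2) is concave on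
    [-lam, lam]; and the expert, a Vovk-Azoury-Warmuth ridge forecaster, loses at
    most lam^2 ln det(I + sum x x^T) against the best polynomial, up to the squared
    norm of its coefficients.  Summing over the pieces gives a deterministic bound
    for sum (y - prediction)^2 - sum (y - theta)^2 whenever all |y| <= lam.

    Expanding y = theta* + sigma eps, the cross terms eps * prediction integrate to 0:
    on each path of the ordering the prediction is a function of past observations,
    and non-anticipation makes eps independent of these by a pi-lambda argument.
    The event that some |y| > lam costs only a constant times lam^2, by the
    sub-Gaussian tails and lam >= 10 sigma sqrt(ln N).  If N = 1 the only
    prediction is 0 and the last term of the bound suffices. *)

(** * Online ridge regression *)

(** The regret bound requires every observation to lie in [-lam, lam], while the cross term has mean
    zero only over the whole probability space: restricting to the good event would destroy the
    orthogonality. Hence nothing is conditioned. A single inequality, [risk_pointwise], holds for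
    every outcome, with a penalty proportional to the sum of the |eps_u| that are at least K. The
    penalty is 0 when all noises are small, and on the bad event it dominates both the trivial error
    bound and a possibly negative cross term. Its integral is at most a constant times (lam + s)^2,
    s being the coefficient bound, because K = 9 sqrt(ln N) makes N^2 exp(-K^2/2) at most 1. The
    constant 10 splits as 1 + 9: a tenth of lam bounds theta*, nine tenths bound sigma K.

    The learning rate 1/(8 lam^2) is the one for which rescaling by 2 lam turns the exponentiated
    loss into exp(-q^2/2) with q in [-1, 1], exactly where that function is concave. *)

Section Ridge.
Variables (R : realType) (L : finType) (p : nat) (x : L -> 'cV[R]_p).

Definition dotc (u v : 'cV[R]_p) : R := (u^T *m v) 0 0.
Definition gram (U : {set L}) : 'M[R]_p := 1%:M + \sum_(u in U) (x u *m (x u)^T).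

Lemma dotcE u v : dotc u v = \sum_i u i 0 * v i 0.
Proof. by rewrite /dotc mxE; apply: eq_bigr => i _; rewrite mxE. Qed.

Lemma dotcC u v : dotc u v = dotc v u.
Proof. by rewrite !dotcE; apply: eq_bigr => i _; rewrite mulrC. Qed.

Lemma dotcDr u v w : dotc u (v + w) = dotc u v + dotc u w.
Proof. by rewrite /dotc mulmxDr mxE. Qed.

Lemma dotcZr a u v : dotc u (a *: v) = a * dotc u v.
Proof. by rewrite /dotc -scalemxAr mxE. Qed.

Lemma dotcNr u v : dotc u (- v) = - dotc u v.
Proof. by rewrite /dotc mulmxN mxE. Qed.

Lemma dotc_sumr (I : finType) (Q : pred I) (F : I -> 'cV[R]_p) u :
  dotc u (\sum_(i | Q i) F i) = \sum_(i | Q i) dotc u (F i).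
Proof. by rewrite /dotc mulmx_sumr summxE. Qed.

Lemma dotc_ge0 u : 0 <= dotc u u.
Proof. by rewrite dotcE sumr_ge0 // => i _; rewrite -expr2 sqr_ge0. Qed.

Lemma dotc_eq0 u : dotc u u = 0 -> u = 0.
Proof.
rewrite dotcE => /eqP; rewrite psumr_eq0; last by move=> i _; rewrite -expr2 sqr_ge0.
move=> /allP u0; apply/matrixP => i j; rewrite ord1 mxE.
by have := u0 i (mem_index_enum i); rewrite implyTb mulf_eq0 orbb => /eqP.
Qed.

Lemma outer_mulmx (a v : 'cV[R]_p) : a *m a^T *m v = dotc a v *: a.
Proof.
rewrite -mulmxA; apply/matrixP => i j; rewrite ord1 !mxE big_ord1 mulrC.
by congr (_ * _); rewrite /dotc.
Qed.

Lemma gram_mulmx U v : gram U *m v = v + \sum_(u in U) dotc (x u) v *: x u.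
Proof.
rewrite /gram mulmxDl mul1mx mulmx_suml; congr (_ + _).
by apply: eq_bigr => u _; rewrite outer_mulmx.
Qed.

Lemma dotc_gram U v w :
  dotc v (gram U *m w) = dotc v w + \sum_(u in U) dotc (x u) w * dotc (x u) v.
Proof.
rewrite gram_mulmx dotcDr dotc_sumr; congr (_ + _).
by apply: eq_bigr => u _; rewrite dotcZr [dotc v _]dotcC.
Qed.

Lemma dotc_gramC U v w : dotc v (gram U *m w) = dotc w (gram U *m v).
Proof.
by rewrite !dotc_gram dotcC; congr (_ + _); apply: eq_bigr => u _; rewrite mulrC.
Qed.

Lemma dotc_gram_ge U v : dotc v v <= dotc v (gram U *m v).
Proof.
rewrite dotc_gram lerDl sumr_ge0 // => u _; by rewrite -expr2 sqr_ge0.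
Qed.

Lemma gram_tr U : (gram U)^T = gram U.
Proof.
rewrite /gram linearD /= trmx1 linear_sum /=; congr (_ + _).
by apply: eq_bigr => u _; rewrite trmx_mul trmxK.
Qed.

(** A vector v in the left kernel would satisfy v . v <= v . (G v) = 0, since G dominates the
    identity. *)
Lemma gram_det_neq0 U : \det (gram U) != 0.
Proof.
apply/negP => /det0P[v v0 vG].
have: gram U *m v^T = 0 by rewrite -[LHS]trmxK trmx_mul trmxK gram_tr vG trmx0.
move=> Gv; have := dotc_gram_ge U v^T; rewrite Gv.
have -> : dotc v^T 0 = 0 by rewrite /dotc mulmx0 mxE.
move=> le0; have /dotc_eq0 vT0 : dotc v^T v^T = 0.
  by apply/eqP; rewrite eq_le le0 dotc_ge0.
by move: v0; rewrite -[v]trmxK vT0 trmx0 eqxx.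
Qed.

Lemma gram_unit U : gram U \in unitmx.
Proof. by rewrite unitmxE unitfE gram_det_neq0. Qed.

(** The leverage score of v with respect to U. *)
Definition lev U v := dotc (x v) (invmx (gram U) *m x v).

Lemma gram_setU1 (U : {set L}) v : v \notin U -> gram (v |: U) = gram U + x v *m (x v)^T.
Proof. by move=> vU; rewrite /gram big_setU1 //= [in RHS]addrAC addrA. Qed.

Lemma gram_invK U (v : 'cV[R]_p) : gram U *m (invmx (gram U) *m v) = v.
Proof. by rewrite mulKVmx // gram_unit. Qed.

Lemma invK_gram U (v : 'cV[R]_p) : invmx (gram U) *m (gram U *m v) = v.
Proof. by rewrite mulKmx // gram_unit. Qed.

(** With z = G^-1 x_v, the leverage is z . G z, a sum of squares one of whose terms is (x_v . z)^2,
    the squared leverage. This confines leverages to [0, 1]. *)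
Lemma lev_sqr (U : {set L}) v : v \in U -> lev U v ^+ 2 <= lev U v.
Proof.
move=> vU; rewrite /lev; set z := invmx _ *m _.
have : dotc (x v) z = dotc z (gram U *m z) by rewrite gram_invK dotcC.
rewrite dotc_gram (bigD1 v) //= -expr2 => E.
have h1 := dotc_ge0 z.
have h2 : 0 <= \sum_(i in U | i != v) dotc (x i) z * dotc (x i) z.
  by apply: sumr_ge0 => i _; rewrite -expr2 sqr_ge0.
lra.
Qed.

Lemma lev_ge0 (U : {set L}) v : v \in U -> 0 <= lev U v.
Proof. by move=> /lev_sqr; apply: le_trans; exact: sqr_ge0. Qed.

Lemma lev_le1 (U : {set L}) v : v \in U -> lev U v <= 1.
Proof. by move=> vU; have := lev_sqr vU; nra. Qed.

(** The matrix determinant lemma: the block matrix with rows (1, a^T) and (a, A) is factored through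
    each of its two Schur complements. *)
Lemma det_rank1_sub (A : 'M[R]_p) (a : 'cV[R]_p) : A \in unitmx ->
  \det (A - a *m a^T) = \det A * (1 - dotc a (invmx A *m a)).
Proof.
move=> uA.
pose B := block_mx (1%:M : 'M[R]_1) a^T a A.
have E1 : B = block_mx 1%:M 0 a 1%:M *m block_mx 1%:M a^T 0 (A - a *m a^T).
  by rewrite mulmx_block !mul1mx !mul0mx !mulmx1 !addr0 addrC subrK.
have E2 : B = block_mx 1%:M (a^T *m invmx A) 0 1%:M
             *m block_mx (1%:M - a^T *m invmx A *m a) 0 a A.
  by rewrite mulmx_block !mul1mx !mul0mx !add0r subrK -[_ *m A]mulmxA mulVmx // mulmx1.
have : \det B = \det B by [].
rewrite {1}E1 E2 !det_mulmx det_lblock det_ublock !det1 !mul1r det_ublock det_lblock.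
rewrite !det1 !mul1r => ->; rewrite mulrC; congr (_ * _).
by rewrite det_mx11 -mulmxA /dotc; set M := (_ *m _)%R; rewrite [M]lock !mxE -lock.
Qed.

Lemma det_gram_setU1 (U : {set L}) v : v \notin U ->
  \det (gram U) = \det (gram (v |: U)) * (1 - lev (v |: U) v).
Proof.
move=> vU; rewrite -det_rank1_sub ?gram_unit //; congr (\det _).
by rewrite gram_setU1 // addrK.
Qed.

Lemma gram_set0 : gram finset.set0 = 1%:M.
Proof. by rewrite /gram big_set0 addr0. Qed.

(** Induction on the size of U: deleting v multiplies the determinant by 1 - lev, which is
    nonnegative, so positivity passes back from the smaller set. *)
Lemma det_gram_gt0 U : 0 < \det (gram U).
Proof.
elim: {U}_.+1 {-2}U (ltnSn #|U|) => // n IH U Un.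
have [->|/set0Pn[v vU]] := eqVneq U finset.set0; first by rewrite gram_set0 det1.
have vUv : v \notin U :\ v by rewrite !inE eqxx.
have : (#|U :\ v| < n)%N by move: Un; rewrite (cardsD1 v) vU.
move=> /IH; rewrite (det_gram_setU1 vUv) finset.setD1K //.
have := lev_le1 vU; set l := lev _ _; set D := \det _ => l1; nra.
Qed.

Variable y : L -> R.
Definition bvec (U : {set L}) := \sum_(u in U) y u *: x u.
(** Closed form of the minimum over b of the ridge objective, squared residuals plus b . b. *)
Definition ridge_obj (U : {set L}) := \sum_(u in U) y u ^+ 2 - dotc (bvec U) (invmx (gram U) *m bvec U).
Definition vaw_pred (U : {set L}) v := dotc (x v) (invmx (gram (v |: U)) *m bvec U).

Lemma ridge_obj_set0 : ridge_obj finset.set0 = 0.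
Proof. by rewrite /ridge_obj /bvec !big_set0 mulmx0 /dotc mulmx0 mxE subr0. Qed.

(** Completing the square: with g the ridge solution, the two sides differ by (b - g) . G (b -
    g). *)
Lemma ridge_obj_le U b :
  ridge_obj U <= \sum_(u in U) (y u - dotc b (x u)) ^+ 2 + dotc b b.
Proof.
set g := invmx (gram U) *m bvec U.
have bE : bvec U = gram U *m g by rewrite gram_invK.
have dE w : dotc w (bvec U) = \sum_(u in U) y u * dotc (x u) w.
  by rewrite dotc_sumr; apply: eq_bigr => u _; rewrite dotcZr [dotc w _]dotcC.
have -> : \sum_(u in U) (y u - dotc b (x u)) ^+ 2
   = \sum_(u in U) y u ^+ 2 - 2 * dotc b (bvec U) + \sum_(u in U) dotc (x u) b * dotc (x u) b.
  rewrite dE mulr_sumr -sumrB -big_split /=; apply: eq_bigr => u _.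
  by rewrite [dotc b _]dotcC; ring.
have := dotc_gram U b b; have := dotc_gram_ge U (b - g); have := dotc_ge0 (b - g).
rewrite mulmxDr mulmxN -bE /ridge_obj -/g.
have dB (w z : 'cV[R]_p) : dotc (b - g) (w - z) = dotc b w - dotc b z - dotc g w + dotc g z.
  by rewrite !dotcDr !dotcNr ![dotc (b - g) _]dotcC !dotcDr !dotcNr ![dotc _ b]dotcC ![dotc _ g]dotcC; ring.
rewrite !dB [dotc g (gram U *m b)]dotc_gramC -bE [dotc (bvec U) g]dotcC.
rewrite [dotc b g]dotcC; lra.
Qed.

(** Let X be the value at v of the ridge solution on U, and l the leverage of v. The forecaster
    predicts (1 - l) X, the minimum of the ridge objective grows by (1 - l)(y - X)^2, and the two
    sides differ by exactly X^2 l (1 - l). *)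
Lemma vaw_step (U : {set L}) v : v \notin U ->
  (y v - vaw_pred U v) ^+ 2 <=
  ridge_obj (v |: U) - ridge_obj U + y v ^+ 2 * lev (v |: U) v.
Proof.
move=> vU; rewrite /ridge_obj /bvec !big_setU1 //= -/(bvec U) /vaw_pred.
set V := v |: U; set b := bvec U.
set g := invmx (gram V) *m b; set z := invmx (gram V) *m x v.
have -> : invmx (gram V) *m (y v *: x v + b) = y v *: z + g.
  by rewrite mulmxDr -scalemxAr.
set be := invmx (gram U) *m b.
have bU : gram U *m be = b by rewrite gram_invK.
have gV : gram V *m g = b by rewrite gram_invK.
have zV : gram V *m z = x v by rewrite gram_invK.
have VE w : gram V *m w = gram U *m w + dotc (x v) w *: x v.
  by rewrite gram_setU1 // mulmxDl outer_mulmx.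
have zg : dotc b z = dotc (x v) g by rewrite -{1}gV dotcC dotc_gramC zV dotcC.
have eq1 : dotc b be = dotc b g + dotc (x v) g * dotc (x v) be.
  have : dotc be (gram V *m g) = dotc g (gram V *m be) by rewrite dotc_gramC.
  rewrite gV VE bU dotcDr dotcZr !(dotcC _ b) !(dotcC _ (x v)) => ->; ring.
(* Having v in the Gram matrix in advance shrinks the previous ridge prediction by the factor 1 -
   lev; this is Sherman-Morrison, obtained by applying [gram V] to [be - g]. *)
have eq2 : dotc (x v) g = dotc (x v) be * (1 - lev V v).
  have : gram V *m (be - g) = dotc (x v) be *: (gram V *m z).
    by rewrite mulmxDr mulmxN gV VE bU zV addrAC subrr add0r.
  rewrite scalemxAr => /(congr1 (mulmx (invmx (gram V)))); rewrite !invK_gram.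
  move=> /(congr1 (dotc (x v))); rewrite dotcDr dotcNr dotcZr -/(lev V v) => e.
  rewrite mulrBr mulr1 -[_ * lev V v]e; ring.
rewrite !dotcDr !dotcZr ![dotc (y v *: x v + b) _]dotcC !dotcDr !dotcZr.
rewrite (dotcC z b) (dotcC g b) (dotcC g (x v)) zg (dotcC z) -/(lev V v) eq1 eq2.
have l0 := lev_ge0 (setU11 v U); have l1 := lev_le1 (setU11 v U).
rewrite -/V in l0 l1.
set X := dotc (x v) be; set l := lev V v in l0 l1 *; set Y := y v.
have : 0 <= X ^+ 2 * ((1 - l) * l).
  by rewrite mulr_ge0 ?sqr_ge0 // mulr_ge0 // subr_ge0.
nra.
Qed.

(** The difference of log determinants is - ln(1 - lev), and it telescopes over the rounds. *)
Lemma lev_le_ln (U : {set L}) v : v \notin U ->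
  lev (v |: U) v <= ln (\det (gram (v |: U))) - ln (\det (gram U)).
Proof.
move=> vU; have D' := det_gram_gt0 (v |: U).
have := det_gram_gt0 U; rewrite (det_gram_setU1 vU) => D.
have l1 : 0 < 1 - lev (v |: U) v by rewrite -(pmulr_rgt0 _ D').
rewrite lnM ?posrE // opprD addNKr lerNr.
by apply: (@le_ln1Dx R (- lev (v |: U) v)); rewrite ltrNl opprK -subr_gt0.
Qed.

(** The Leibniz expansion has p! terms, each a product of p entries of size at most 1 + |U|. The
    factor p! depends only on m and d, so this crude bound suffices. *)
Lemma ln_det_gram_le (U : {set L}) : (forall u i, `|x u i 0| <= 1) ->
  ln (\det (gram U)) <= ln (p`!%:R) + p%:R * ln (1 + #|U|%:R).
Proof.
move=> x1.
have gU i j : `|gram U i j| <= 1 + #|U|%:R.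
  rewrite !mxE summxE (le_trans (ler_normD _ _)) // lerD //.
    by case: eqP; rewrite ?normr1 ?normr0 ?ler01.
  rewrite (le_trans (ler_norm_sum _ _ _)) // -sum1_card natr_sum ler_sum // => u _.
  by rewrite !mxE big_ord1 normrM !mxE -[1%:R]mulr1 ler_pM.
have U0 : 0 < 1 + #|U|%:R :> R by rewrite ltr_pwDl.
have : \det (gram U) <= p`!%:R * (1 + #|U|%:R) ^+ p.
  rewrite (le_trans (ler_norm _)) // (le_trans (ler_norm_sum _ _ _)) //.
  have -> : p`!%:R * (1 + #|U|%:R) ^+ p = \sum_(s : {perm 'I_p}) (1 + #|U|%:R) ^+ p :> R.
    rewrite sumr_const mulr_natl -card_Sn.
    by congr (_ *+ _); apply: eq_card.
  apply: ler_sum => s _; rewrite normrM normr_sign mul1r normr_prod.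
  rewrite -[X in _ <= _ ^+ X]card_ord -prodr_const ler_prod // => i _.
  by rewrite normr_ge0 gU.
have p0 : 0 < p`!%:R * (1 + #|U|%:R) ^+ p :> R.
  by rewrite mulr_gt0 ?exprn_gt0 // ltr0n fact_gt0.
rewrite -(ler_ln (det_gram_gt0 U) p0).
by rewrite lnM ?posrE ?exprn_gt0 ?ltr0n ?fact_gt0 // lnXn // mulr_natl.
Qed.
End Ridge.

(** * Cumulative sums along an ordering *)

Section Cumulative.
Variables (R : realType) (L : eqType).

(** The argument of [G] is the history strictly before u. Histories are duplicate free in every use,
    so [index] finds the round of u and [cumul_rcons] allows induction on time. *)
Definition cumul (D : pred L) (G : seq L -> L -> R) (h : seq L) : R :=
  \sum_(u <- h | D u) G (take (index u h) h) u.

Lemma cumul_nil D G : cumul D G [::] = 0.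
Proof. by rewrite /cumul big_nil. Qed.

Lemma cumul_rcons D G h v : v \notin h ->
  cumul D G (rcons h v) = cumul D G h + (if D v then G h v else 0).
Proof.
move=> vh; rewrite /cumul big_rcons /=.
have -> : take (index v (rcons h v)) (rcons h v) = h.
  by rewrite -cats1 index_cat (negbTE vh) /= eqxx addn0 take_size_cat.
have -> // : \sum_(u <- h | D u) G (take (index u (rcons h v)) (rcons h v)) u =
          \sum_(u <- h | D u) G (take (index u h) h) u.
rewrite big_seq_cond [RHS]big_seq_cond; apply: eq_bigr => u /andP[uh _].
by rewrite -cats1 index_cat uh takel_cat // ltnW // index_mem.
Qed.
End Cumulative.

(** * Aggregation of specialists *)

Section ExpConcave.
Variable R : realType.
Implicit Types p q x : R.

(** For p and x in [-1, 1] the factor 1 - p x is nonnegative, so the derivative has the sign of x -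
    p and the function is minimal at p. *)
Lemma gauss_tangent_derive p x :
  is_derive x 1 (fun q => (1 + p ^+ 2 - p * q) * expR (q ^+ 2 / 2))
    (expR (x ^+ 2 / 2) * ((x - p) * (1 - p * x))).
Proof.
have d1 : is_derive x 1 (fun q : R => q ^+ 2 / 2) x.
  rewrite (_ : (fun q => _) = (2^-1 : R) \*: (@id R) ^+ 2); last first.
    by apply/funext => q /=; rewrite fctE /= mulrC.
  apply: is_derive_eq; rewrite /= expr1 /GRing.scale /=; lra.
have d2 : is_derive x 1 (fun q : R => 1 + p ^+ 2 - p * q) (- p).
  rewrite (_ : (fun q => _) = cst (1 + p ^+ 2) - p \*: (@id R)); last first.
    by apply/funext => q /=; rewrite fctE.
  by apply: is_derive_eq; rewrite sub0r /GRing.scale /= mulr1.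
have d3 : is_derive x 1 (expR \o (fun q : R => q ^+ 2 / 2)) (expR (x ^+ 2 / 2) * x).
  exact: (is_derive1_comp (is_derive_expR _) d1).
apply: (is_derive_eq (is_deriveM d2 d3)).
by rewrite /= /GRing.scale /=; ring.
Qed.

(** The graph of exp(-q^2/2) lies below its tangent at p, here multiplied by exp(p^2/2). *)
Lemma exp_tangent p q : -1 <= p <= 1 -> -1 <= q <= 1 ->
  expR ((p ^+ 2 - q ^+ 2) / 2) <= 1 + p ^+ 2 - p * q.
Proof.
move=> /andP[p1 p2] /andP[q1 q2].
pose f q := (1 + p ^+ 2 - p * q) * expR (q ^+ 2 / 2).
pose df x := expR (x ^+ 2 / 2) * ((x - p) * (1 - p * x)).
have cf x : {for x, continuous f}.
  by apply/differentiable_continuous/derivable1_diffP; case: (gauss_tangent_derive p x).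
have fp : f p = expR (p ^+ 2 / 2).
  by rewrite /f -expr2 addrK mul1r.
have main : f p <= f q.
  have [pq|/ltW qp] := leP p q.
    have [|c] := @MVT_segment R f df p q pq (fun x _ => gauss_tangent_derive p x).
      by apply: continuous_subspaceT => x; exact: cf.
    rewrite in_itv /= => /andP[c1 c2] E; rewrite -subr_ge0 E.
    by rewrite mulr_ge0 ?subr_ge0 // mulr_ge0 ?expR_ge0 // mulr_ge0 ?subr_ge0 //; nra.
  have [|c] := @MVT_segment R f df q p qp (fun x _ => gauss_tangent_derive p x).
    by apply: continuous_subspaceT => x; exact: cf.
  rewrite in_itv /= => /andP[c1 c2] E; rewrite -subr_le0 E.
  rewrite mulr_le0_ge0 ?subr_ge0 // mulr_ge0_le0 ?expR_ge0 // mulr_le0_ge0 ?subr_ge0 ?subr_le0 //; nra.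
by rewrite [_ / 2]mulrBl expRB ler_pdivrMr ?expR_gt0 // -fp.
Qed.
End ExpConcave.

Section Aggregation.
Variables (R : realType) (d k m : nat) (lam : R).
Local Notation L := (lattice d (2 ^ k)).
Hypothesis lam0 : 0 < lam.
Variable y : L -> R.
Local Notation trunc := (trunc lam).
Local Notation alpha := (alpha lam).
Local Notation expert_pred := (expert_pred m y).
Local Notation loss := (loss m lam y).
Local Notation weights := (weights m lam y).
Local Notation olr_pred := (olr_pred m lam y).

Lemma trunc_itv x : - lam <= trunc x <= lam.
Proof.
rewrite /Defs.trunc le_min ge_min lexx orbT andbT le_max lexx orbT /=; have := lam0; lra.
Qed.

Lemma trunc_id x : `|x| <= lam -> trunc x = x.
Proof.
rewrite ler_norml => /andP[x1 x2].
by rewrite /Defs.trunc max_l // min_l.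
Qed.

Lemma trunc_contract (x z : R) : `|x| <= lam -> (x - trunc z) ^+ 2 <= (x - z) ^+ 2.
Proof.
rewrite ler_norml /Defs.trunc => /andP[x1 x2].
have l0 := lam0; have [h1|h1] := leP z (- lam).
  by rewrite (@min_l _ _ (- lam)); nra.
have [h2|h2] := leP z lam; nra.
Qed.

Lemma alpha_gt0 : 0 < alpha.
Proof. by rewrite invr_gt0 mulr_gt0 // exprn_gt0. Qed.

(** After division of z - t and z0 - t by 2 lam, [alpha] times the square loss becomes q^2/2 and
    [exp_tangent] applies. *)
Lemma exp_loss_tangent (z z0 t : R) :
  - lam <= z <= lam -> - lam <= z0 <= lam -> - lam <= t <= lam ->
  expR (- alpha * (t - z) ^+ 2) <=
  expR (- alpha * (t - z0) ^+ 2) * (1 - 2 * alpha * (z0 - t) * (z - z0)).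
Proof.
move=> hz hz0 ht.
have l0 : lam != 0 by rewrite gt_eqF.
pose p := (z0 - t) / (2 * lam); pose q := (z - t) / (2 * lam).
have bnd (x : R) : - lam <= x <= lam -> -1 <= (x - t) / (2 * lam) <= 1.
  move=> hx; rewrite ler_pdivlMr ?ler_pdivrMr ?mulr_gt0 //; lra.
have := exp_tangent (bnd _ hz0) (bnd _ hz); rewrite -/p -/q => H.
rewrite -ler_pdivrMl ?expR_gt0 // -expRN -expRD.
rewrite (_ : _ + _ = (p ^+ 2 - q ^+ 2) / 2); last first.
  by rewrite /p /q /Defs.alpha; field.
rewrite (_ : 1 - _ = 1 + p ^+ 2 - p * q) //.
by rewrite /p /q /Defs.alpha; field.
Qed.

Lemma weights_rcons h v : weights (rcons h v) = update m lam y (weights h) h v.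
Proof.
rewrite /Defs.weights; set F := (fun st v => _); set st0 := (_, [::]).
have E g : (foldl F st0 g).2 = g by elim/last_ind: g => // g u IH; rewrite foldl_rcons /= IH.
by rewrite foldl_rcons /= E.
Qed.

Lemma card_dyadic_gt0 : (0 < #|dyadic_rects d k|)%N.
Proof.
apply/card_gt0P; exists [set: L]; rewrite inE.
apply/existsP; exists [ffun => ord_max]; apply/existsP; exists [ffun => inord 1].
have k0 : (0 < 2 ^ k)%N by rewrite expn_gt0.
apply/andP; split.
  by apply/forallP => i; rewrite !ffunE inordK // /= subnn.
apply/eqP/setP => u; rewrite !inE; symmetry; apply/forallP => i.
by rewrite !ffunE inordK //= mul1n /lcoord ltn_ord ?andbT.
Qed.

Lemma weights_gt0 h S : 0 < weights h S.
Proof.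
elim/last_ind: h S => [|h v IH] S.
  by rewrite /weights /= /w0 invr_gt0 ltr0n card_dyadic_gt0.
rewrite weights_rcons /update; case: ifP => // SA.
have pos (F : {set L} -> R) : (forall X, 0 < F X) -> 0 < \sum_(X in active h v) F X.
  by move=> F0; rewrite (bigD1 S) //= ltr_pwDl // sumr_ge0 // => X _; exact: ltW.
rewrite !mulr_gt0 ?invr_gt0 ?expR_gt0 ?pos // => X.
by rewrite mulr_gt0 ?expR_gt0.
Qed.

(** An update only redistributes mass among the active experts. Its use is that no single weight
    exceeds 1. *)
Lemma sum_weights h : \sum_(S in dyadic_rects d k) weights h S = 1.
Proof.
elim/last_ind: h => [|h v IH].
  rewrite /weights /= /w0 sumr_const -[LHS]mulr_natl mulfV //.
  by rewrite pnatr_eq0 -lt0n card_dyadic_gt0.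
rewrite -{}IH weights_rcons /update.
have sA : active h v \subset dyadic_rects d k.
  by apply/fintype.subsetP => S; rewrite inE => /andP[].
have spl (F : {set L} -> R) : \sum_(S in dyadic_rects d k) F S =
    \sum_(S in active h v) F S + \sum_(S in dyadic_rects d k :\: active h v) F S.
  by rewrite (big_setID (active h v)) /= (finset.setIidPr sA).
rewrite !spl; congr (_ + _); last first.
  by apply: eq_bigr => S; rewrite inE => /andP[/negbTE ->].
rewrite (eq_bigr (fun S => weights h S * expR (- alpha * loss h S v) *
   ((\sum_(S in active h v) weights h S * expR (- alpha * loss h S v))^-1
     * \sum_(S in active h v) weights h S))); last first.
  by move=> S ->; rewrite !mulrA.
rewrite -mulr_suml mulrA.
have [->|[S SA]] := set_0Vmem (active h v); first by rewrite !big_set0 !mulr0.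
rewrite divff ?mul1r // gt_eqF // (bigD1 S) //= ltr_pwDl //.
  by rewrite mulr_gt0 ?expR_gt0 ?weights_gt0.
by rewrite sumr_ge0 // => X _; rewrite mulr_ge0 ?expR_ge0 // ltW ?weights_gt0.
Qed.

Lemma olr_pred_itv h v : - lam <= olr_pred h v <= lam.
Proof.
rewrite /Defs.olr_pred /=; set A := active h v; set W := \sum_(S in A) weights h S.
have [A0|[S SA]] := set_0Vmem A.
  have -> : \sum_(S in A) weights h S / W * trunc (expert_pred h S v) = 0.
    by rewrite A0 big_set0.
  by rewrite oppr_le0 ltW.
have W0 : 0 < W.
  rewrite /W (bigD1 S) //= ltr_pwDl ?weights_gt0 //.
  by rewrite sumr_ge0 // => X _; rewrite ltW ?weights_gt0.
have W1 : \sum_(S in A) weights h S / W = 1 by rewrite -mulr_suml divff // gt_eqF.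
apply/andP; split.
  rewrite -[- lam]mul1r -W1 mulr_suml ler_sum // => X _.
  rewrite ler_pM2l ?divr_gt0 ?weights_gt0 //; by case/andP: (trunc_itv (expert_pred h X v)).
rewrite -[leRHS]mul1r -W1 mulr_suml ler_sum // => X _.
rewrite ler_pM2l ?divr_gt0 ?weights_gt0 //; by case/andP: (trunc_itv (expert_pred h X v)).
Qed.

Definition agg_loss h v := (trunc (y v) - olr_pred h v) ^+ 2.

(** Jensen's inequality through the tangent at the aggregated prediction z0: the linear terms cancel
    because z0 is the weighted mean of the truncated experts. *)
Lemma agg_jensen h v : active h v != finset.set0 ->
  \sum_(S in active h v) weights h S * expR (- alpha * loss h S v) <=
  expR (- alpha * agg_loss h v) * \sum_(S in active h v) weights h S.
Proof.
move=> /set0Pn[S0 S0A]; set A := active h v; set W := \sum_(S in A) weights h S.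
have W0 : 0 < W.
  rewrite /W (bigD1 S0) //= ltr_pwDl ?weights_gt0 //.
  by rewrite sumr_ge0 // => X _; rewrite ltW ?weights_gt0.
set z0 := olr_pred h v; set t := trunc (y v).
have E : \sum_(S in A) weights h S * (trunc (expert_pred h S v) - z0) = 0.
  under eq_bigr do rewrite mulrBr.
  rewrite sumrB -mulr_suml -/W; apply/eqP; rewrite subr_eq0; apply/eqP.
  rewrite /z0 /Defs.olr_pred /= -/A -/W mulr_sumr; apply: eq_bigr => S _.
  by rewrite mulrA [W * _]mulrC divfK ?lt0r_neq0.
have -> : expR (- alpha * agg_loss h v) * W =
   \sum_(S in A) weights h S * (expR (- alpha * (t - z0) ^+ 2) *
      (1 - 2 * alpha * (z0 - t) * (trunc (expert_pred h S v) - z0))).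
  set c := expR (- alpha * (t - z0) ^+ 2).
  rewrite (eq_bigr (fun S => c * weights h S - c * (2 * alpha * (z0 - t)) *
    (weights h S * (trunc (expert_pred h S v) - z0)))); last by move=> S _; ring.
  by rewrite sumrB -!mulr_sumr E mulr0 subr0.
apply: ler_sum => S _; rewrite ler_pM2l ?weights_gt0 //.
by apply: exp_loss_tangent; rewrite ?trunc_itv ?olr_pred_itv.
Qed.

(** The logarithm of the weight of D serves as potential: whenever D is active, it rises by at least
    [alpha] times the excess loss of the aggregate. Rounds outside D leave it fixed. *)
Lemma agg_regret_inv (D : {set L}) h : D \in dyadic_rects d k -> uniq h ->
  cumul (fun u => u \in D) (fun h v => agg_loss h v - loss h D v) h <=
  (ln (weights h D) + ln #|dyadic_rects d k|%:R) / alpha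
   + 4 * lam ^+ 2 * (has (fun u => u \in D) h)%:R.
Proof.
move=> DD; have N0 := card_dyadic_gt0.
elim/last_ind: h => [_|h v IH].
  by rewrite cumul_nil mulr0 addr0 /weights /= /w0 lnV ?posrE ?ltr0n // addNr mul0r.
rewrite rcons_uniq => /andP[vh uh]; rewrite cumul_rcons //; have {}IH := IH uh.
rewrite has_rcons weights_rcons /update.
case: (boolP (v \in D)) => vD /=; last first.
  rewrite addr0 /= ifF // inE (negbTE vD) /= andbF //.
have [DA|DA] := ifP.
  have A0 : active h v != finset.set0 by apply/set0Pn; exists D.
  set Ze := \sum_(S in _) _ * _; set Z := \sum_(S in _) _.
  have Ze0 : 0 < Ze.
    rewrite /Ze (bigD1 D) //= ltr_pwDl ?mulr_gt0 ?expR_gt0 ?weights_gt0 //.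
    by rewrite sumr_ge0 // => X _; rewrite mulr_ge0 ?expR_ge0 // ltW ?weights_gt0.
  have Z0 : 0 < Z.
    rewrite /Z (bigD1 D) //= ltr_pwDl ?weights_gt0 //.
    by rewrite sumr_ge0 // => X _; rewrite ltW ?weights_gt0.
  have := agg_jensen A0; rewrite -/Ze -/Z -(ler_ln Ze0) ?posrE ?mulr_gt0 ?expR_gt0 //.
  rewrite lnM ?posrE ?expR_gt0 // expRK => J.
  rewrite !lnM ?lnV ?posrE ?mulr_gt0 ?invr_gt0 ?expR_gt0 ?weights_gt0 // expRK.
  have a0 := alpha_gt0.
  have : cumul (fun u => u \in D) (fun h v => agg_loss h v - loss h D v) h <=
     (ln (weights h D) + ln #|dyadic_rects d k|%:R) / alpha + 4 * lam ^+ 2.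
    apply: (le_trans IH); rewrite lerD2l; case: has; rewrite ?mulr1 // mulr0.
    by rewrite mulr_ge0 // sqr_ge0.
  rewrite mulr1 => {}IH.
  apply: (le_trans (lerD IH (lexx _))).
  rewrite addrAC lerD2r -lerBrDl -mulrBl ler_pdivlMr //; lra.
(* D is asleep at its first visited point unless that is the first round of all. This one round is
   paid for by 4 lam^2, since both values lie in [-lam, lam]. *)
have hD : has (fun u => u \in D) h = false.
  by move: DA; rewrite inE DD vD /= => /negbT; rewrite negb_or => /andP[_ /negbTE].
move: IH; rewrite hD mulr0 addr0 mulr1 => IH; rewrite lerD //.
have := olr_pred_itv h v; have := trunc_itv (y v).
rewrite /agg_loss => /andP[t1 t2] /andP[z1 z2].
have l1 : 0 <= loss h D v by rewrite sqr_ge0.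
have : (trunc (y v) - olr_pred h v) ^+ 2 <= 4 * lam ^+ 2.
  nra.
lra.
Qed.
End Aggregation.

(** * Dyadic decomposition of rectangles *)

Section Dyadic.
Variables (d k : nat).
Local Notation n := (2 ^ k)%N.
Local Notation L := (lattice d n).

(** The level-s dyadic interval around x is contained in [a, b]. Coordinates are counted from 0
    here, and the right end is exclusive. *)
Definition dy_fits (a b x s : nat) : bool :=
  (a <= x %/ 2 ^ s * 2 ^ s)%N && ((x %/ 2 ^ s).+1 * 2 ^ s <= b.+1)%N.

(** The maximum makes sense for a <= x <= b because level 0, the singleton of x, always fits. *)
Definition dy_lev (a b x : nat) : 'I_k.+1 :=
  [arg max_(s > ord0 | dy_fits a b x (s : 'I_k.+1)) (s : nat)].

Lemma dy_levP (a b x : nat) : (a <= x <= b)%N ->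
  dy_fits a b x (dy_lev a b x) /\
  (forall s : nat, (s <= k)%N -> dy_fits a b x s -> (s <= dy_lev a b x)%N).
Proof.
move=> /andP[ax xb]; rewrite /dy_lev; case: arg_maxnP => [|s sP smax].
  by rewrite /dy_fits /= expn0 divn1 !muln1 ax ltnS.
by split=> // s' s'k; have := smax (Ordinal (n:=k.+1) (m:=s') s'k); apply.
Qed.

Lemma dy_fits_itv a b x z s : dy_fits a b x s -> (z %/ 2 ^ s = x %/ 2 ^ s)%N ->
  (a <= z <= b)%N.
Proof.
move=> /andP[f1 f2] E; have s0 : (0 < 2 ^ s)%N by rewrite expn_gt0.
rewrite -E in f1 f2.
rewrite (leq_trans f1) ?leq_trunc_div //= -ltnS (leq_trans _ f2) //.
by rewrite ltn_ceil.
Qed.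

Lemma dy_div_up x z s s' : (s <= s')%N -> (z %/ 2 ^ s = x %/ 2 ^ s)%N ->
  (z %/ 2 ^ s' = x %/ 2 ^ s')%N.
Proof. by move=> ss' E; rewrite -(subnKC ss') expnD !divnMA E. Qed.

(** Two points of one maximal interval have the same maximal interval; hence these intervals
    partition [a, b]. *)
Lemma dy_lev_eq a b x z : (a <= x <= b)%N ->
  (z %/ 2 ^ dy_lev a b x = x %/ 2 ^ dy_lev a b x)%N ->
  dy_lev a b z = dy_lev a b x.
Proof.
move=> axb E; have [Px mx] := dy_levP axb.
have azb := dy_fits_itv Px E; have [Pz mz] := dy_levP azb.
have le1 : (dy_lev a b x <= dy_lev a b z)%N.
  by apply: mz; [rewrite -ltnS ltn_ord|rewrite /dy_fits E].
apply/val_inj/eqP; rewrite eqn_leq le1 andbT; apply: mx; first by rewrite -ltnS ltn_ord.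
by move: Pz; rewrite /dy_fits (dy_div_up le1 E).
Qed.

(** Index at level s of the right child of the parent holding a - 1 ([true]), or of the left child
    of the parent holding b + 1 ([false]). *)
Definition dy_code (a b s : nat) (side : bool) : nat :=
  (if side then (2 * (a.-1 %/ 2 ^ s.+1)).+1 else 2 * (b.+1 %/ 2 ^ s.+1))%N.

(* A maximal dyadic interval inside [a, b] is a child of a dyadic interval that
   contains a - 1 or b + 1, hence there are at most two of them at each level. *)
Lemma dy_lev_code a b x : (a <= x <= b)%N -> (b < n)%N ->
  exists side, (x %/ 2 ^ dy_lev a b x)%N = dy_code a b (dy_lev a b x) side.
Proof.
move=> axb bn; have [Px mx] := dy_levP axb; set s := dy_lev a b x in Px mx *.
have s0 : (0 < 2 ^ s)%N by rewrite expn_gt0.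
move: Px => /andP[f1 f2]; set c := (x %/ 2 ^ s)%N in f1 f2 *.
have := ltn_ord s; rewrite ltnS leq_eqVlt => /orP[/eqP sk|sk].
  (* At the top level there is no parent within range. The only interval has index 0, which the code
     [false] yields because b + 1 < 2^(k+1). *)
  exists false; rewrite /dy_code divn_small; last by rewrite sk expnS; lia.
  rewrite muln0 /c divn_small // sk; lia.
have : ~~ dy_fits a b x s.+1 by apply/negP => /(mx _ sk); rewrite ltnn.
rewrite /dy_fits expnSr divnMA -/c negb_and -!ltnNge /dy_code expnSr.
set M := (2 ^ s)%N in s0 f1 f2 *; set e := (c %/ 2)%N.
have c2 : c = (e * 2 + c %% 2)%N by rewrite -divn_eq.
have m2 : (c %% 2 < 2)%N by rewrite ltn_mod.
have M2 : (0 < M * 2)%N by rewrite muln_gt0 s0.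
have eS : (e.+1 * (M * 2) = e * M + e * M + M + M)%N by rewrite mulSn; lia.
have e0 : (e * (M * 2) = e * M + e * M)%N by lia.
rewrite eS e0 => /orP[h|h].
  have cE : c = (e * 2).+1.
    have : (e * 2 * M < c * M)%N by lia.
    by rewrite ltn_pmul2r //; lia.
  have cM : (c * M = e * M + e * M + M)%N by rewrite cE mulSn; lia.
  exists true; suff -> : (a.-1 %/ (M * 2) = e)%N by rewrite mulnC.
  by apply/eqP; rewrite eqn_leq -ltnS ltn_divLR // leq_divRL // eS e0; lia.
have cE : c = (e * 2)%N.
  have : (c.+1 * M < (e * 2).+2 * M)%N by rewrite !mulSn; lia.
  by rewrite ltn_pmul2r //; lia.
have cM : (c.+1 * M = e * M + e * M + M)%N by rewrite cE mulSn; lia.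
exists false; suff -> : (b.+1 %/ (M * 2) = e)%N by rewrite mulnC.
by apply/eqP; rewrite eqn_leq -ltnS ltn_divLR // leq_divRL // eS e0; lia.
Qed.

(** The piece of u is the product of the maximal intervals of its coordinates. The cover is a map
    whose fibres in S are the pieces, so that sums over S regroup by [partition_big_imset]. *)
Lemma rect_dyadic_cover (S : {set L}) : is_rect S ->
  exists c : L -> {set L},
   [/\ forall u, u \in S -> c u \in dyadic_rects d k,
       forall u v, u \in S -> (v \in c u) = (v \in S) && (c v == c u) &
       (#|c @: S| <= (2 * k.+1) ^ d)%N].
Proof.
move=> /existsP[a /existsP[b /andP[/forallP ab /eqP SE]]].
pose lv (u : L) i := dy_lev (a i) (b i) (u i).
pose c (u : L) : {set L} := [set v : L | [forall i, v i %/ 2 ^ lv u i == u i %/ 2 ^ lv u i]%N].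
have inS u : (u \in S) -> forall i, (a i <= u i <= b i)%N.
  by rewrite SE inE => /forallP.
exists c; split.
- move=> u uS; rewrite inE; apply/existsP; exists [ffun i => lv u i].
  apply/existsP; exists [ffun i => inord (u i %/ 2 ^ lv u i).+1].
  have q i : (u i %/ 2 ^ lv u i < 2 ^ (k - lv u i))%N.
    rewrite ltn_divLR ?expn_gt0 // -expnD subnK ?ltn_ord //.
    by rewrite -ltnS ltn_ord.
  have q' i : ((u i %/ 2 ^ lv u i).+1 < (2 ^ k).+1)%N.
    by rewrite ltnS (leq_trans (q i)) // leq_exp2l // leq_subr.
  apply/andP; split; first by apply/forallP => i; rewrite !ffunE inordK //= q.
  apply/eqP/setP => v; rewrite !inE; apply: eq_forallb => i.
  rewrite !ffunE inordK //= /lcoord ltnS.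
  have s0 : (0 < 2 ^ lv u i)%N by rewrite expn_gt0.
  by rewrite eqn_leq andbC -leq_divRL // -ltn_divLR // ltnS.
- move=> u v uS; apply/idP/andP => [|[vS /eqP <-]]; last first.
    by rewrite inE; apply/forallP.
  rewrite inE => /forallP vu.
  have lvE i : lv v i = lv u i by apply: dy_lev_eq; [exact: inS|exact/eqP/vu].
  split.
    rewrite SE inE; apply/forallP => i.
    by have [f _] := dy_levP (inS u uS i); apply: (dy_fits_itv f); exact/eqP/vu.
  apply/eqP/setP => w; rewrite !inE; apply: eq_forallb => i.
  by rewrite lvE (eqP (vu i)).
(* A piece is determined by a level and a side in each coordinate, which gives 2(k+1) choices per
   coordinate. *)
pose pc (f : {ffun 'I_d -> 'I_k.+1 * bool}) : {set L} :=
  [set v : L | [forall i, v i %/ 2 ^ (f i).1 == dy_code (a i) (b i) (f i).1 (f i).2]%N].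
have sub : c @: S \subset [set pc f | f : {ffun 'I_d -> 'I_k.+1 * bool}].
  apply/fintype.subsetP => _ /imsetP[u uS ->].
  (* By [dy_lev_code] the pick always succeeds, so the default [true] below is never reached. *)
  pose sd i := [pick side | (u i %/ 2 ^ lv u i == dy_code (a i) (b i) (lv u i) side)%N].
  apply/imsetP; exists [ffun i => (lv u i, odflt true (sd i))] => //.
  apply/setP => v; rewrite !inE; apply: eq_forallb => i; rewrite !ffunE /= /sd.
  case: pickP => [s /eqP <- //|no].
  have [s sE] := dy_lev_code (inS u uS i) (ltn_ord (b i)).
  by have := no s; rewrite /lv sE eqxx.
apply: (leq_trans (subset_leq_card sub)).
rewrite (leq_trans (leq_imset_card _ _)) // card_ffun card_prod !card_ord card_bool.
by rewrite mulnC.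
Qed.

(** Counting pairs (s, a) is wasteful, but after taking logarithms the square costs only a factor 2
    over ln(2^d N). *)
Lemma card_dyadic_le : (#|dyadic_rects d k| <= (2 ^ d * n ^ d) ^ 2)%N.
Proof.
pose f (x : {ffun 'I_d -> 'I_k.+1} * {ffun 'I_d -> 'I_n.+1}) : {set L} :=
  [set u | [forall i, ((x.2 i).-1 * 2 ^ x.1 i < lcoord u i)%N
                                  && (lcoord u i <= x.2 i * 2 ^ x.1 i)%N]].
have sub : dyadic_rects d k \subset f @: finset.setT.
  apply/fintype.subsetP => S; rewrite inE => /existsP[s /existsP[a /andP[_ /eqP ->]]].
  by apply/imsetP; exists (s, a).
apply: (leq_trans (subset_leq_card sub)).
rewrite (leq_trans (leq_imset_card _ _)) // cardsT card_prod !card_ffun !card_ord.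
rewrite -!expnMn -[leqRHS]expnM [(d * 2)%N]mulnC expnM.
have kn : (k < n)%N by rewrite ltn_expl.
have le1 : (n.+1 * k.+1 <= (2 * n) ^ 2)%N by rewrite expnS expn1 leq_mul //; lia.
have pow_mono (A B e : nat) : (A <= B -> A ^ e <= B ^ e)%N.
  by move=> AB; elim: e => // e IH; rewrite !expnS leq_mul.
by apply: pow_mono; rewrite [leqLHS]mulnC.
Qed.
End Dyadic.

(** * Regret on a single dyadic piece *)

Section Pieces.
Variables (R : realType) (d k m : nat) (lam : R).
Local Notation n := (2 ^ k)%N.
Local Notation L := (lattice d n).
Local Notation p := #|monos d m|.
Hypothesis lam0 : 0 < lam.
Variable y : L -> R.
Hypothesis ylam : forall u, `|y u| <= lam.
Local Notation ft := (@feat R d k m).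

Lemma feat_le1 (u : L) i : `|ft u i 0| <= 1.
Proof.
rewrite mxE normr_prod prodr_ile1 // => j _; rewrite normr_ge0 /= normrX exprn_ile1 //.
have n0 : 0 < n%:R :> R by rewrite ltr0n expn_gt0.
by rewrite ger0_norm ?divr_ge0 // ler_pdivrMr // mul1r ler_nat ltn_ord.
Qed.

Lemma expert_pred_vaw h D v :
  expert_pred m y h D v = vaw_pred ft y ([set u in h] :&: D) v.
Proof. by []. Qed.

(** [vaw_step] and [lev_le_ln] telescope: the ridge objective and the log determinant both start at
    0 on the empty history, and y^2 <= lam^2. *)
Lemma vaw_regret (D : {set L}) h : uniq h ->
  cumul (fun u => u \in D) (fun h v => (y v - expert_pred m y h D v) ^+ 2) h <=
  ridge_obj ft y ([set u in h] :&: D)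
   + lam ^+ 2 * ln (\det (gram ft ([set u in h] :&: D))).
Proof.
elim/last_ind: h => [_|h v IH].
  have -> : [set u in [::]] :&: D = finset.set0 by apply/setP => u; rewrite !inE.
  by rewrite cumul_nil ridge_obj_set0 gram_set0 det1 ln1 mulr0 addr0.
rewrite rcons_uniq => /andP[vh uh]; rewrite cumul_rcons //; have {}IH := IH uh.
case: (boolP (v \in D)) => vD; last first.
  rewrite addr0; suff -> : [set u in rcons h v] :&: D = [set u in h] :&: D by [].
  apply/setP => u; rewrite !inE mem_rcons inE; case: eqP => //= ->.
  by rewrite (negbTE vD) !andbF.
set U := [set u in h] :&: D in IH *.
have -> : [set u in rcons h v] :&: D = v |: U.
  apply/setP => u; rewrite !inE mem_rcons inE; case: eqP => //= ->; by rewrite vD.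
have vU : v \notin U by rewrite !inE (negbTE vh).
have := vaw_step ft y vU; rewrite -expert_pred_vaw => st.
have lv := lev_le_ln ft vU; have lv0 := lev_ge0 ft (setU11 v U).
have y2 : y v ^+ 2 <= lam ^+ 2.
  by rewrite -[y v ^+ 2]real_normK ?num_real // ler_sqr ?nnegrE // ltW.
have h1 : y v ^+ 2 * lev ft (v |: U) v <= lam ^+ 2 * lev ft (v |: U) v.
  exact: ler_wpM2r.
have h2 : lam ^+ 2 * lev ft (v |: U) v <= lam ^+ 2 *
  (ln (\det (gram ft (v |: U))) - ln (\det (gram ft U))).
  by rewrite ler_wpM2l // sqr_ge0.
lra.
Qed.

Lemma cumul_full (D : {set L}) (G : seq L -> L -> R) s : uniq s -> (forall u, u \in s) ->
  cumul (fun u => u \in D) G s = \sum_(u in D) G (take (index u s) s) u.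
Proof.
move=> us sT; rewrite /cumul; apply: perm_big; apply: uniq_perm => //.
  exact: index_enum_uniq.
by move=> u; rewrite sT mem_index_enum.
Qed.

Lemma piece_regret (D : {set L}) s (b : 'cV[R]_p) : D \in dyadic_rects d k ->
  uniq s -> (forall u, u \in s) ->
  \sum_(u in D) (y u - olr_pred m lam y (take (index u s) s) u) ^+ 2 <=
  \sum_(u in D) (y u - dotc b (ft u)) ^+ 2 + dotc b b +
  lam ^+ 2 * (ln p`!%:R + p%:R * ln (1 + (n ^ d)%:R)
    + 8 * ln #|dyadic_rects d k|%:R + 4).
Proof.
move=> DD us sT.
have A1 := agg_regret_inv m lam0 y DD us.
have A2 := vaw_regret D us; have sD : [set u in s] :&: D = D.
  by apply/setP => u; rewrite !inE sT.
rewrite sD !cumul_full // in A1 A2.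
have A3 := ridge_obj_le ft y D b.
have A4 := ln_det_gram_le D feat_le1.
have lw : ln (weights m lam y s D) <= 0.
  rewrite -ln1 ler_ln ?posrE ?weights_gt0 //.
  rewrite -(sum_weights m lam y s) (bigD1 D) //= lerDl sumr_ge0 // => X _.
  by rewrite ltW ?weights_gt0.
(* Since |y| <= lam, truncating y changes nothing and truncating the expert can only bring it closer
   to y. *)
have A5 : \sum_(u in D) loss m lam y (take (index u s) s) D u <=
  \sum_(u in D) (y u - expert_pred m y (take (index u s) s) D u) ^+ 2.
  by apply: ler_sum => u _; rewrite /loss trunc_id // trunc_contract.
have A6 : \sum_(u in D) (y u - olr_pred m lam y (take (index u s) s) u) ^+ 2 =
   \sum_(u in D) agg_loss m lam y (take (index u s) s) u.
  by apply: eq_bigr => u _; rewrite /agg_loss trunc_id.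
rewrite sumrB -A6 in A1.
have A7 : ln (1 + #|D|%:R) <= ln (1 + (n ^ d)%:R) :> R.
  rewrite ler_ln ?posrE ?ltr_pwDl // lerD2l ler_nat (leq_trans (max_card _)) //.
  by rewrite card_ffun !card_ord.
have A8 : lam ^+ 2 * ln (\det (gram ft D)) <=
   lam ^+ 2 * (ln p`!%:R + p%:R * ln (1 + (n ^ d)%:R)).
  rewrite ler_wpM2l ?sqr_ge0 // (le_trans A4) // lerD2l ler_wpM2l //.
have A9 : (ln (weights m lam y s D) + ln #|dyadic_rects d k|%:R) / alpha lam <=
  8 * lam ^+ 2 * ln #|dyadic_rects d k|%:R.
  rewrite /alpha invrK [leLHS]mulrC; apply: ler_wpM2l; first by rewrite mulr_ge0 // sqr_ge0.
  by rewrite gerDr.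
have A10 : 4 * lam ^+ 2 * (has (fun u => u \in D) s)%:R <= 4 * lam ^+ 2.
  by case: has; rewrite ?mulr1 // mulr0 mulr_ge0 // sqr_ge0.
lra.
Qed.
End Pieces.

(** * Deterministic regret over a partition *)

Section Regret.
Variables (R : realType) (d k m : nat) (lam : R).
Local Notation n := (2 ^ k)%N.
Local Notation L := (lattice d n).
Local Notation p := #|monos d m|.
Hypothesis lam0 : 0 < lam.

Definition reg_const (s : R) : R := p%:R * s ^+ 2 +
  lam ^+ 2 * (ln p`!%:R + p%:R * ln (1 + (n ^ d)%:R)
    + 8 * ln #|dyadic_rects d k|%:R + 4).

Lemma reg_const_ge0 s : 0 <= reg_const s.
Proof.
apply: addr_ge0; first by rewrite mulr_ge0 ?sqr_ge0.
rewrite mulr_ge0 ?sqr_ge0 // !addr_ge0 // ?mulr_ge0 //.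
- by rewrite ln_ge0 // ler1n fact_gt0.
- by rewrite ln_ge0 // lerDl.
- by rewrite ln_ge0 // ler1n card_dyadic_gt0.
Qed.

(** The features are monomials in u/n, so the coefficients absorb n^|m|. Their entries are then what
    [s_m_inf] controls. *)
Definition coefs (beta : {ffun 'I_d -> 'I_m.+1} -> R) : 'cV[R]_p :=
  \col_j (n%:R ^+ absmono (enum_val j) * beta (enum_val j)).

Lemma dotc_coefs beta (u : L) : dotc (coefs beta) (@feat R d k m u) =
  \sum_(mm in monos d m) beta mm * \prod_(i < d) (lcoord u i)%:R ^+ mm i.
Proof.
rewrite dotcE [RHS]big_enum_val /=; apply: eq_bigr => j _; rewrite !mxE.
have n0 : n%:R != 0 :> R by rewrite pnatr_eq0 -lt0n expn_gt0.
rewrite [X in _ * X = _](eq_bigr _ (fun i _ => expr_div_n _ _ _)).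
rewrite big_split /= prodfV /absmono -prodrXr [_ * beta _]mulrC -!mulrA; congr (_ * _).
rewrite mulrCA divff ?mulr1 //; apply/prodf_neq0 => i _; by rewrite expf_neq0.
Qed.

Lemma s_m_inf_ge0 (Pt : {set {set L}}) beta : 0 <= @s_m_inf R d n m Pt beta.
Proof. exact: bigmax_ge_id. Qed.

Lemma le_s_m_inf (Pt : {set {set L}}) (beta : {set L} -> {ffun 'I_d -> 'I_m.+1} -> R) S mm :
  S \in Pt -> mm \in monos d m ->
  n%:R ^+ absmono mm * `|beta S mm| <= s_m_inf Pt beta.
Proof.
move=> SP mP; rewrite /s_m_inf; apply: (bigmax_sup S) => //.
exact: (bigmax_sup mm).
Qed.

Lemma dotc_coefs_le (Pt : {set {set L}}) (beta : {set L} -> {ffun 'I_d -> 'I_m.+1} -> R) S :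
  S \in Pt -> dotc (coefs (beta S)) (coefs (beta S)) <= p%:R * s_m_inf Pt beta ^+ 2.
Proof.
move=> SP; rewrite dotcE mulr_natl -[X in _ *+ X]card_ord -sumr_const ler_sum // => j _.
rewrite -expr2 !mxE -[leLHS]real_normK ?num_real // ler_sqr ?nnegrE ?s_m_inf_ge0 //.
by rewrite normrM normrX normr_nat le_s_m_inf // enum_valP.
Qed.

Lemma theta_le (Pt : {set {set L}}) (beta : {set L} -> {ffun 'I_d -> 'I_m.+1} -> R) S (u : L) :
  S \in Pt ->
  `|\sum_(mm in monos d m) beta S mm * \prod_(i < d) (lcoord u i)%:R ^+ mm i| <=
  p%:R * s_m_inf Pt beta.
Proof.
move=> SP; rewrite -dotc_coefs dotcE (le_trans (ler_norm_sum _ _ _)) //.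
rewrite mulr_natl -[X in _ *+ X]card_ord -sumr_const ler_sum // => j _.
rewrite normrM -[leRHS]mulr1 ler_pM // ?feat_le1 //.
by rewrite !mxE normrM normrX normr_nat le_s_m_inf // enum_valP.
Qed.

(** All dyadic pieces of a rectangle S are compared with the same polynomial, and each piece pays
    [reg_const] once. *)
Lemma partition_regret (y : L -> R) (r : 'I_(n ^ d) -> L) (T : {set L})
    (Pt : {set {set L}}) (theta : L -> R)
    (beta : {set L} -> {ffun 'I_d -> 'I_m.+1} -> R) :
  (forall u, `|y u| <= lam) -> bijective r -> rect_partition Pt T ->
  (forall S, S \in Pt -> forall u, u \in S ->
     theta u = \sum_(mm in monos d m)
                 beta S mm * \prod_(i < d) (lcoord u i)%:R ^+ mm i) ->
  \sum_(u in T) (y u - olradre m lam r y u) ^+ 2 <=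
  \sum_(u in T) (y u - theta u) ^+ 2
    + #|Pt|%:R * (((2 * k.+1) ^ d)%N%:R * reg_const (s_m_inf Pt beta)).
Proof.
move=> ylam [r' rK r'K] /andP[/and3P[/eqP <- tP _] /forallP rP] thE.
rewrite /olradre; set s := [seq r i | i <- _].
have us : uniq s by rewrite map_inj_uniq ?enum_uniq //; exact: can_inj rK.
have sT u : u \in s by apply/mapP; exists (r' u); rewrite ?mem_enum // r'K.
rewrite !finset.big_trivIset //= mulr_natl -sumr_const -big_split /=; apply: ler_sum => S SP.
have /rect_dyadic_cover[c [c1 c2 c3]] : is_rect S by have := rP S; rewrite SP.
set K := reg_const _.
have K0 : 0 <= K := reg_const_ge0 _.
rewrite (partition_big_imset c) [in leRHS](partition_big_imset c) /=.
apply: (@le_trans _ _ (\sum_(D in c @: S) (\sum_(u in S | c u == D) (y u - theta u) ^+ 2 + K))).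
  apply: ler_sum => D /imsetP[u uS ->].
  have piece F : \sum_(v in S | c v == c u) F v = \sum_(v in c u) F v :> R.
    by apply: eq_bigl => v; rewrite c2.
  rewrite !piece (le_trans (piece_regret lam0 ylam (coefs (beta S)) (c1 u uS) us sT)) //.
  rewrite -addrA; apply: lerD; last by rewrite /K /reg_const lerD2r; exact: dotc_coefs_le.
  apply: ler_sum => v; rewrite c2 // => /andP[vS _].
  by rewrite dotc_coefs -thE.
rewrite big_split /= lerD2l sumr_const -[leLHS]mulr_natl ler_wpM2r //.
by rewrite ler_nat.
Qed.

(** The factor 2 / ln 2 compares 2(k+1) with ln(en). Terms free of logarithms are divided by ln 2, a
    lower bound of ln(2^d N) for d > 0; 16 is 8 from 1/[alpha] times 2 from [card_dyadic_le]. *)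
Definition det_const : R := (2 / ln 2) ^+ d *
   ((p%:R + ln p`!%:R + 4) / ln 2 + p%:R + 16).

Lemma ln2_gt0 : 0 < ln 2 :> R.
Proof. by rewrite ln_gt0 // ltr1n. Qed.

Lemma ln_en : ln (expR 1 * n%:R) = 1 + k%:R * ln 2 :> R.
Proof.
rewrite lnM ?posrE ?expR_gt0 ?ltr0n ?expn_gt0 // expRK natrX lnXn //.
by rewrite mulr_natl.
Qed.

Lemma ln_en_ge1 : 1 <= ln (expR 1 * n%:R) :> R.
Proof. by rewrite ln_en lerDl mulr_ge0 // ltW // ln2_gt0. Qed.

Lemma reg_const_le s : (0 < d)%N -> 0 <= s ->
  ((2 * k.+1) ^ d)%N%:R * reg_const s <=
  det_const * (lam + s) ^+ 2 * ln (expR 1 * n%:R) ^+ d * ln ((2 ^ d * n ^ d)%N%:R).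
Proof.
move=> d0 s0; set l := ln ((2 ^ d * n ^ d)%N%:R).
have ln20 := ln2_gt0.
have N0 : (0 < n ^ d)%N by rewrite !expn_gt0.
(* Positivity of d enters here: it gives both ln 2 <= l and 1 + N <= 2^d N. *)
have D2 : (2 <= 2 ^ d)%N by rewrite -{1}[2%N]expn1 leq_exp2l.
have l2 : ln 2 <= l.
  rewrite ler_ln ?posrE ?ltr0n ?muln_gt0 ?N0 ?expn_gt0 // ler_nat; nia.
have lN : ln (1 + (n ^ d)%:R) <= l.
  rewrite ler_ln ?posrE ?ltr0n ?ltr_pwDl ?muln_gt0 ?N0 ?expn_gt0 //.
  rewrite nat1r ler_nat; nia.
have lS : ln #|dyadic_rects d k|%:R <= 2 * l.
  rewrite mulr_natl -lnXn ?ltr0n ?muln_gt0 ?N0 ?expn_gt0 // ler_ln ?posrE.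
  - by rewrite -natrX ler_nat card_dyadic_le.
  - by rewrite ltr0n card_dyadic_gt0.
  - by rewrite exprn_gt0 // ltr0n muln_gt0 N0 expn_gt0.
have ki : ((2 * k.+1) ^ d)%N%:R <= (2 / ln 2) ^+ d * ln (expR 1 * n%:R) ^+ d :> R.
  rewrite natrX -exprMn lerXn2r ?nnegrE ?mulr_ge0 ?invr_ge0 // ?(ltW ln20) //.
    by rewrite (le_trans _ ln_en_ge1).
  rewrite ln_en natrM -mulrA ler_wpM2l // mulrC ler_pdivlMr //.
  have : ln 2 <= 1 :> R by rewrite (le_trans (le_ln1Dx _)) //; lra.
  rewrite -natr1; lra.
have ls := (lerDl lam s); rewrite s0 in ls.
have ss : s ^+ 2 <= (lam + s) ^+ 2.
  by rewrite ler_sqr ?nnegrE // ?lerDr ?addr_ge0 // ltW.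
have sl : lam ^+ 2 <= (lam + s) ^+ 2.
  by rewrite ler_sqr ?nnegrE // ?addr_ge0 // ltW.
have l0 : 0 <= l := le_trans (ltW ln20) l2.
have pf0 : 0 <= ln p`!%:R :> R by rewrite ln_ge0 // ler1n fact_gt0.
have inl (x : R) : 0 <= x -> x <= x / ln 2 * l.
  by move=> x0; rewrite -{1}[x](divfK (lt0r_neq0 ln20)) ler_wpM2l // divr_ge0 // ltW.
have B : reg_const s <= (lam + s) ^+ 2 * (((p%:R + ln p`!%:R + 4) / ln 2 + p%:R + 16) * l).
  rewrite /reg_const; apply: (@le_trans _ _ ((lam + s) ^+ 2 * (p%:R + (ln p`!%:R +
     p%:R * ln (1 + (n ^ d)%:R) + 8 * ln #|dyadic_rects d k|%:R + 4)))).
    rewrite [leRHS]mulrDr [_ * p%:R]mulrC; apply: lerD; first by rewrite ler_wpM2l.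
    rewrite ler_wpM2r // !addr_ge0 // mulr_ge0 // ln_ge0 //.
      by rewrite lerDl.
    by rewrite ler1n card_dyadic_gt0.
  rewrite ler_wpM2l ?sqr_ge0 //.
  have := inl _ (ler0n R p); have := inl _ pf0; have := inl 4 (ler0n R 4).
  have : p%:R * ln (1 + (n ^ d)%:R) <= p%:R * l by rewrite ler_wpM2l.
  rewrite !mulrDl; lra.
have E0 : 0 <= (p%:R + ln p`!%:R + 4) / ln 2 + p%:R + 16 :> R.
  by rewrite !addr_ge0 // divr_ge0 ?(ltW ln20) // !addr_ge0.
apply: (le_trans (ler_wpM2l (ler0n _ _) B)).
apply: (le_trans (ler_wpM2r _ ki)); first by rewrite mulr_ge0 ?sqr_ge0 // mulr_ge0.
rewrite /det_const le_eqVlt; apply/orP; left; apply/eqP; ring.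
Qed.
End Regret.

Local Open Scope classical_set_scope.

(** * Measurability of the predictor *)

Section PredMeasurable.
Variables (R : realType) (d k m : nat) (lam : R).
Local Notation n := (2 ^ k)%N.
Local Notation L := (lattice d n).
Hypothesis lam0 : 0 < lam.
Context (dO : measure_display) (Om : measurableType dO) (Y : L -> Om -> R).

Lemma measurable_fun_fsum (I : finType) (P : pred I) (F : I -> Om -> R) :
  (forall i, P i -> measurable_fun setT (F i)) ->
  measurable_fun setT (fun w => \sum_(i | P i) F i w).
Proof.
move=> mF; under eq_fun do rewrite big_mkcond /=.
by apply: measurable_sum => i; case: (boolP (P i)) => Pi; [exact: mF|exact: measurable_cst].
Qed.

(** Along a fixed history the ridge prediction is linear in the observations. Only those in [h] are
    assumed measurable, so that the result also applies to the sigma-algebra of the past. *)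
Lemma measurable_expert_pred h S v :
  (forall u, u \in h -> measurable_fun setT (Y u)) ->
  measurable_fun setT (fun w => expert_pred m (Y^~ w) h S v).
Proof.
move=> mY; pose x := @feat R d k m.
pose U := [set u in h]%SET :&: S.
have -> : (fun w => expert_pred m (Y^~ w) h S v) = (fun w =>
    \sum_(u in U) Y u w * dotc (x v) (invmx (gram x (v |: U)) *m x u)).
  apply/funext => w; rewrite expert_pred_vaw /vaw_pred /bvec mulmx_sumr dotc_sumr.
  by apply: eq_bigr => u _; rewrite -scalemxAr dotcZr.
apply: measurable_fun_fsum => u; rewrite !inE => /andP[uh _].
by apply: measurable_funM; [exact: mY|exact: measurable_cst].
Qed.

Lemma measurable_trunc (f : Om -> R) : measurable_fun setT f ->
  measurable_fun setT (fun w => trunc lam (f w)).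
Proof.
by move=> mf; apply: measurable_minr => //; apply: measurable_maxr.
Qed.

Lemma measurable_invr_gt0 (f : Om -> R) : measurable_fun setT f ->
  (forall w, 0 < f w) -> measurable_fun setT (fun w => (f w)^-1).
Proof.
move=> mf f0; rewrite (_ : (fun w => _) = (fun w => expR (- ln (f w)))); last first.
  by apply/funext => w; rewrite expRN lnK ?posrE.
apply: measurableT_comp; first exact: measurable_expR.
by apply: measurable_funN; apply: measurableT_comp => //; exact: measurable_ln.
Qed.

Lemma measurable_weights h S :
  (forall u, u \in h -> measurable_fun setT (Y u)) ->
  measurable_fun setT (fun w => weights m lam (Y^~ w) h S).
Proof.
elim/last_ind: h S => [|h v IH] S mY; first exact: measurable_cst.
have mh u : u \in h -> measurable_fun setT (Y u).
  by move=> uh; apply: mY; rewrite mem_rcons inE uh orbT.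
have mv : measurable_fun setT (Y v) by apply: mY; rewrite mem_rcons inE eqxx.
under eq_fun do rewrite weights_rcons /update.
case: (boolP (S \in active h v)) => SA; last exact: IH.
have mE X : measurable_fun setT (fun w =>
    weights m lam (Y^~ w) h X * expR (- alpha lam * loss m lam (Y^~ w) h X v)).
  apply: measurable_funM; first exact: IH.
  apply: measurableT_comp; first exact: measurable_expR.
  apply: measurable_funM => //; apply: measurable_funX.
  apply: measurable_funB; apply: measurable_trunc => //.
  exact: measurable_expert_pred.
apply: measurable_funM; last by apply: measurable_fun_fsum => X _; exact: IH.
apply: measurable_funM; first exact: mE.
apply: measurable_invr_gt0; first by apply: measurable_fun_fsum => X _; exact: mE.
move=> w; rewrite (bigD1 S) //= ltr_pwDl ?mulr_gt0 ?weights_gt0 ?expR_gt0 //.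
by rewrite sumr_ge0 // => X _; rewrite mulr_ge0 ?expR_ge0 // ltW ?weights_gt0.
Qed.

Lemma measurable_olr_pred h v :
  (forall u, u \in h -> measurable_fun setT (Y u)) ->
  measurable_fun setT (fun w => olr_pred m lam (Y^~ w) h v).
Proof.
move=> mY; rewrite /olr_pred /=.
apply: measurable_fun_fsum => S SA; apply: measurable_funM; last first.
  by apply: measurable_trunc; exact: measurable_expert_pred.
apply: measurable_funM; first exact: measurable_weights.
apply: measurable_invr_gt0.
  by apply: measurable_fun_fsum => X _; exact: measurable_weights.
move=> w; rewrite (bigD1 S) //= ltr_pwDl ?weights_gt0 //.
by rewrite sumr_ge0 // => X _; rewrite ltW ?weights_gt0.
Qed.
End PredMeasurable.

(** * Sub-Gaussian tails *)

Section Tails.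
Context (R : realType) (dO : measure_display) (Om : measurableType dO)
  (P : probability Om R) (e : Om -> R).
Hypothesis me : measurable_fun setT e.
Hypothesis te : forall x : R, 0 <= x ->
     (P [set w | (x <= e w)%R] <= (2 * expR (- (x ^+ 2) / 2))%:E)%E /\
     (P [set w | (e w <= - x)%R] <= (2 * expR (- (x ^+ 2) / 2))%:E)%E.

Definition tail_part (K : R) (w : Om) : R := `|e w| * \1_[set w | K <= `|e w|] w.

Lemma measurable_ge_norm (x : R) : measurable [set w | x <= `|e w|].
Proof.
rewrite -[X in measurable X]setTI.
have -> : [set w | x <= `|e w|] = (fun w => `|e w|) @^-1` `[x, +oo[%classic.
  by apply/seteqP; split => w /=; rewrite in_itv /= andbT.
have mn : measurable_fun setT (fun w => `|e w|) by exact: measurableT_comp.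
by apply: mn => //; exact: measurable_itv.
Qed.

Lemma measurable_tail_part K : measurable_fun setT (tail_part K).
Proof.
apply: measurable_funM; first exact: measurableT_comp.
by apply: measurable_indic; exact: measurable_ge_norm.
Qed.

Lemma prob_ge_norm (x : R) : 0 <= x ->
  (P [set w | (x <= `|e w|)%R] <= (4 * expR (- (x ^+ 2) / 2))%:E)%E.
Proof.
move=> x0; have [h1 h2] := te x0.
have m1 : measurable [set w | x <= e w].
  rewrite -[X in measurable X]setTI (_ : [set w | _] = e @^-1` `[x, +oo[%classic).
    by apply: me => //; exact: measurable_itv.
  by apply/seteqP; split => w /=; rewrite in_itv /= andbT.
have m2 : measurable [set w | e w <= - x].
  rewrite -[X in measurable X]setTI (_ : [set w | _] = e @^-1` `]-oo, (- x)]%classic).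
    by apply: me => //; exact: measurable_itv.
  by apply/seteqP; split => w /=; rewrite in_itv.
have -> : [set w | x <= `|e w|] = [set w | x <= e w] `|` [set w | e w <= - x].
  apply/seteqP; split => w /=; rewrite ler_normr lerNr; first by move/orP.
  by move=> h; apply/orP.
apply: le_trans; first by apply: measureU2.
rewrite (_ : 4 * _ = 2 * expR (- x ^+ 2 / 2) + 2 * expR (- x ^+ 2 / 2)); last by ring.
by rewrite EFinD; exact: leeD.
Qed.

(** If 2^j K <= |e| < 2^(j+1) K, the j-th term alone already dominates |e|. *)
Lemma tail_part_series (K : R) (w : Om) : 0 < K ->
  ((tail_part K w)%:E <= \sum_(j <oo)
    (2 ^+ j.+1 * K * \1_[set w | 2 ^+ j * K <= `|e w|] w)%:E)%E.
Proof.
move=> K0; rewrite /tail_part.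
have t0 j : (0 <= (2 ^+ j.+1 * K * \1_[set w | 2 ^+ j * K <= `|e w|] w)%:E :> \bar R)%E.
  by rewrite lee_fin !mulr_ge0 // ?exprn_ge0 // ltW.
have [Ke|Ke] := leP K `|e w|; last first.
  rewrite indicE memNset ?mulr0; last by move=> /=; rewrite leNgt Ke.
  by apply: nneseries_ge0 => j _ _; exact: t0.
have ex : exists j, `|e w| < 2 ^+ j.+1 * K.
  pose N := (Num.bound (`|e w| / K)); exists N.
  rewrite -ltr_pdivrMr //; apply: (@lt_le_trans _ _ N%:R).
    by apply: archi_boundP; rewrite divr_ge0 // ltW.
  by rewrite -natrX ler_nat ltnW // ltnW // -[X in (X < _)%N]/(N.+1) ltn_expl.
have [j jP jmin] := ex_minnP ex.
have lo : 2 ^+ j * K <= `|e w|.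
  case: j jP jmin => [|j] jP jmin; first by rewrite expr0 mul1r.
  by rewrite leNgt; apply/negP => /jmin; rewrite ltnn.
rewrite (nneseriesD1 (n := j)) //.
apply: (@le_trans _ _ (2 ^+ j.+1 * K * \1_[set w | 2 ^+ j * K <= `|e w|] w)%:E).
  rewrite lee_fin !indicE !mem_set // !mulr1; exact: ltW.
by rewrite leeDl // nneseries_ge0 // => i _ _; exact: t0.
Qed.

Lemma integral_tail_part (K : R) : 2 <= K ->
  (\int[P]_w (tail_part K w)%:E <= (16 * K * expR (- K ^+ 2 / 2))%:E)%E.
Proof.
move=> K2; have K0 : 0 < K by lra.
pose f j w := (2 ^+ j.+1 * K * \1_[set w | 2 ^+ j * K <= `|e w|] w)%:E : \bar R.
have f0 j w : (0 <= f j w)%E by rewrite lee_fin !mulr_ge0 // ?exprn_ge0 // ltW.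
have mf j : measurable_fun setT (f j).
  apply/measurable_EFinP; apply: measurable_funM => //.
  by apply: measurable_indic; exact: measurable_ge_norm.
apply: (@le_trans _ _ (\int[P]_w (\sum_(j <oo) f j w))%E).
  apply: ge0_le_integral => //.
  - by move=> w _; rewrite lee_fin mulr_ge0.
  - exact/measurable_EFinP/measurable_tail_part.
  - by apply: ge0_emeasurable_sum.
  - by move=> w _; exact: tail_part_series.
rewrite integral_nneseries //.
(* A geometric majorant whose weights 2^-(j+1) sum to 1; it remains to compare term by term. *)
apply: (@le_trans _ _ (\sum_(j <oo) ((16 * K * expR (- K ^+ 2 / 2)) / (2 ^ j.+1)%:R)%:E)%E); last first.
  by apply: epsilon_trick0; rewrite !mulr_ge0 ?expR_ge0 // ltW.
apply: lee_nneseries => [j _ _|j _]; first exact: integral_ge0.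
have mj := measurable_ge_norm (2 ^+ j * K).
under eq_integral do rewrite /f EFinM.
rewrite ge0_integralZl //=; last first.
- by rewrite lee_fin mulr_ge0 // ?exprn_ge0 // ltW.
- by apply/measurable_EFinP; exact: measurable_indic.
rewrite integral_indic // setIT.
have jK0 : 0 <= 2 ^+ j * K by rewrite mulr_ge0 ?exprn_ge0 // ltW.
apply: (le_trans (lee_wpmul2l _ (prob_ge_norm jK0))).
  by rewrite lee_fin mulr_ge0 // ?exprn_ge0 // ltW.
rewrite -EFinM lee_fin natrX.
have j1 : 1 <= 2 ^+ j :> R by rewrite exprn_ege1 // ler1n.
set x := 2 ^+ j in j1 *.
have xE : 2 ^+ j.+1 = 2 * x by rewrite exprS.
rewrite xE.
(* From exp(t) >= 1 + t with t = (x^2 - 1) K^2/2; this is where K is bounded below, through K^2/2 >=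
   1. *)
have key : expR (- (x * K) ^+ 2 / 2) * x ^+ 2 <= expR (- K ^+ 2 / 2).
  rewrite -ler_pdivlMl ?expR_gt0 // -expRN -expRD.
  rewrite (_ : _ + _ = (x ^+ 2 - 1) * (K ^+ 2 / 2)); last by field.
  apply: le_trans (expR_ge1Dx _).
  have x2 : 0 <= x ^+ 2 - 1 by rewrite subr_ge0 exprn_ege1.
  have k2 : 1 <= K ^+ 2 / 2 by nra.
  nra.
rewrite ler_pdivlMr; last by lra.
rewrite [leLHS](_ : _ = 16 * K * (expR (- (x * K) ^+ 2 / 2) * x ^+ 2)); last by ring.
by rewrite ler_wpM2l // mulr_ge0 // ltW.
Qed.

Lemma tail_part_ge0 K w : 0 <= tail_part K w.
Proof. by rewrite mulr_ge0. Qed.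

Lemma integrable_tail_part K : 2 <= K -> P.-integrable setT (EFin \o tail_part K).
Proof.
move=> K2; apply/integrableP; split; first exact/measurable_EFinP/measurable_tail_part.
under eq_integral do rewrite /= ger0_norm ?tail_part_ge0 //.
by apply: (le_lt_trans (integral_tail_part K2)); rewrite ltry.
Qed.

Lemma integrable_noise : P.-integrable setT (EFin \o e).
Proof.
have i2 : P.-integrable setT (fun w => (2%:E + (tail_part 2 w)%:E)%E).
  apply: integrableD => //; last exact: integrable_tail_part.
  by apply: finite_measure_integrable_cst.
apply: le_integrable i2 => //; first exact/measurable_EFinP.
move=> w _; rewrite /= lee_fin [leRHS]ger0_norm; last first.
  by rewrite addr_ge0 ?tail_part_ge0.
rewrite /tail_part indicE; have [h|h] := leP 2 `|e w|.
  by rewrite mem_set // mulr1 lerDr.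
by rewrite memNset ?mulr0 ?addr0 ?ltW //=; rewrite leNgt h.
Qed.
End Tails.

(** * Orthogonality of predictions and noise *)

Section Independence.
Context (R : realType) (dO : measure_display) (Om : measurableType dO)
  (P : probability Om R) (e : Om -> R).
Hypothesis me : measurable_fun setT e.
Hypothesis ie : P.-integrable setT (EFin \o e).
Hypothesis e0 : (\int[P]_w (e w)%:E = 0)%E.

(** The joint law of (X, e) agrees with the product law on rectangles, hence everywhere. By Fubini
    the inner integral over e is g(x) times the mean of e, which is 0. *)
Lemma indep_integral_mul0 (d1 : measure_display) (T1 : measurableType d1)
    (X : Om -> T1) (g : T1 -> R) (c : R) :
  measurable_fun setT X ->
  (forall A B, measurable A -> measurable B ->
     P (X @^-1` A `&` e @^-1` B) = (P (X @^-1` A) * P (e @^-1` B))%E) ->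
  measurable_fun setT g -> (forall x, `|g x| <= c) ->
  (\int[P]_w (g (X w) * e w)%:E = 0)%E.
Proof.
move=> mX indep mg gc.
pose X' : {mfun Om >-> T1} := HB.pack X (isMeasurableFun.Build _ _ _ _ X mX).
pose e' : {mfun Om >-> R} := HB.pack e (isMeasurableFun.Build _ _ _ _ e me).
pose F w := (X w, e w).
have mF : measurable_fun setT F by exact/measurable_fun_pair.
pose F' : {mfun Om >-> (T1 * R)%type} := HB.pack F (isMeasurableFun.Build _ _ _ _ F mF).
pose h (z : T1 * R) : \bar R := (g z.1 * z.2)%:E.
have mh : measurable_fun setT h.
  apply/measurable_EFinP; apply: measurable_funM; last exact: measurable_snd.
  by apply: measurableT_comp => //; exact: measurable_fst.
have ih : P.-integrable setT (h \o F).
  have i2 : P.-integrable setT (fun w => (c%:E * (e w)%:E)%E).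
    exact: integrableZl.
  apply: le_integrable i2 => //.
    by apply: measurableT_comp.
  move=> w _; rewrite /= lee_fin !normrM ler_wpM2r //.
  by rewrite (le_trans (gc _)) // ler_norm.
have key B C : measurable B -> measurable C ->
    distribution P F' (B `*` C) = (distribution P X' B * distribution P e' C)%E.
  by move=> mB mC; rewrite /distribution /pushforward /= -indep.
rewrite -[LHS]/(\int[P]_w (h \o F') w)%E -integral_distribution //.
rewrite (eq_measure_integral (distribution P X' \x distribution P e')%E); last first.
  move=> A mA _; symmetry; exact: product_measure_unique.
rewrite -integral12_prod_meas1 /fubini_F /h /=; last first.
  apply/integrableP; split => //.
  rewrite (eq_measure_integral (distribution P F')); last first.
    move=> A mA _; exact: product_measure_unique.
  have /integrableP[_] := integrable_pushforward mF mh ih measurableT.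
  by [].
under eq_integral => x _.
  under eq_integral do rewrite EFinM.
  rewrite integralZl //; last first.
    exact: (@integrable_pushforward _ _ _ _ _ e me P setT EFin).
  rewrite integral_distribution //= e0 mule0; over.
by rewrite integral0.
Qed.

(** The pi-lambda step: independence is known on [G] only, while g is measurable for the
    sigma-algebra it generates. *)
Lemma pi_indep_integral_mul0 (G : set (set Om)) (g : Om -> R) (c : R) :
  setI_closed G -> G setT -> (forall A, G A -> measurable A) ->
  (forall A B, G A -> measurable B -> P (A `&` e @^-1` B) = (P A * P (e @^-1` B))%E) ->
  measurable_fun setT (g : g_sigma_algebraType G -> R) ->
  (forall x, `|g x| <= c) ->
  (\int[P]_w (g w * e w)%:E = 0)%E.
Proof.
move=> GI GT Gm indep mg gc.
have sGm A : <<s G >> A -> measurable A.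
  by apply: smallest_sub => //; exact: sigma_algebra_measurable.
(* The random element is the identity, with the coarser sigma-algebra on its target. *)
have mX : measurable_fun setT (id : Om -> g_sigma_algebraType G).
  by move=> _ A mA; rewrite setTI; exact: sGm.
apply: (indep_integral_mul0 mX _ mg gc) => A B mA mB; rewrite !preimage_id.
have meB : measurable (e @^-1` B) by rewrite -[X in measurable X]setTI; exact: me.
(* For fixed B, the measures A |-> P(A and e in B) and A |-> P(A) P(e in B) are finite and agree on
   [G]. *)
pose m1 := mrestr P meB.
have pB : (0 <= fine (P (e @^-1` B)))%R by rewrite fine_ge0.
pose m2 : {measure set Om -> \bar R} := mscale (NngNum pB) P.
have PBE : ((fine (P (e @^-1` B)))%:E = P (e @^-1` B))%E.
  by rewrite fineK // fin_num_measure.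
have m2E C : m2 C = (P C * P (e @^-1` B))%E.
  by rewrite /m2 /= /mscale /= PBE muleC.
rewrite -m2E -[LHS]/(m1 A).
apply: (g_sigma_algebra_measure_unique G _ (fun=> setT)) => //.
- by rewrite bigcup_const.
- by move=> C GC; rewrite m2E; exact: indep.
- move=> _; rewrite /= /mrestr setTI (le_lt_trans (probability_le1 P meB)) //.
  exact: ltry.
Qed.
End Independence.

Section Orthogonality.
Variables (R : realType) (d k m : nat) (lam : R).
Local Notation n := (2 ^ k)%N.
Local Notation L := (lattice d n).
Local Notation N := (n ^ d)%N.
Hypothesis lam0 : 0 < lam.

Definition prefix_seq (t : 'I_N) (r : 'I_N -> L) : seq L :=
  [seq r i | i <- take t (enum 'I_N)].

(* Freezing r at u from time t on makes (t, r) a unique code for the event that u is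
   visited at time t after the path r. *)
Definition visit_code (u : L) (z : 'I_N * {ffun 'I_N -> L}) : bool :=
  [forall i : 'I_N, (z.1 <= i)%N ==> (z.2 i == u)].

Lemma mem_take_enum (t i : 'I_N) : (i \in take t (enum 'I_N)) = (i < t)%N.
Proof.
by rewrite in_take_leq ?index_enum_ord ?mem_enum // size_enum_ord ltnW.
Qed.

Context (dO : measure_display) (Om : measurableType dO) (P : probability Om R)
  (sigma : R) (theta_star : L -> R) (eps : L -> Om -> R) (rho : Om -> 'I_N -> L).
Hypothesis meps : forall s, measurable_fun setT (eps s).
Hypothesis rho_bij : forall w, bijective (rho w).
Hypothesis mrho : forall t s, measurable [set w | rho w t = s].

Definition observation (v : L) (w : Om) : R := theta_star v + sigma * eps v w.

Lemma measurable_obs v : measurable_fun setT (observation v).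
Proof. by apply: measurable_funD => //; apply: measurable_funM. Qed.

Definition path_event (t : 'I_N) (r : 'I_N -> L) : set Om :=
  [set w | forall i : 'I_N, (i <= t)%N -> rho w i = r i].

Lemma measurable_path_event t r : measurable (path_event t r).
Proof.
have -> : path_event t r = \bigcap_(i in [set i : 'I_N | (i <= t)%N]) [set w | rho w i = r i].
  by apply/seteqP; split => w /= h i; exact: h.
by apply: fin_bigcap_measurable => //; exact: finite_finset.
Qed.

(** For each outcome exactly one code contributes. The random-order predictor thus becomes a finite
    sum of predictors along deterministic paths. *)
Lemma olradre_visit_sum w u : olradre m lam (rho w) (observation^~ w) u =
  \sum_(z | visit_code u z) \1_(path_event z.1 z.2) w
     * olr_pred m lam (observation^~ w) (prefix_seq z.1 z.2) u.
Proof.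
have [r' rK r'K] := rho_bij w; set t0 := r' u.
have rt0 : rho w t0 = u by rewrite /t0 r'K.
pose r0 := [ffun i : 'I_N => if (i < t0)%N then rho w i else u].
rewrite (bigD1 (t0, r0)) /=; last first.
  by apply/forallP => i /=; apply/implyP => ti; rewrite ffunE ltnNge ti.
rewrite big1 ?addr0; last first.
  move=> [t r] /= /andP[/forallP /= cr ne]; rewrite indicE memNset ?mul0r // => ev.
  move/negP: ne; apply.
  have rt : r t = u by have := cr t; rewrite leqnn => /eqP.
  have tE : t = t0 by apply: (can_inj rK); rewrite rt0 (ev t (leqnn _)).
  rewrite tE in cr ev *; rewrite xpair_eqE eqxx /=; apply/eqP/ffunP => i; rewrite ffunE.
  case: ltnP => ti; first by rewrite ev // ltnW.
  by have := cr i; rewrite ti => /eqP.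
rewrite indicE mem_set ?mul1r; last first.
  move=> i it; rewrite ffunE; case: ltnP => // ti.
  by rewrite -rt0; congr (rho w _); apply/val_inj/eqP; rewrite eqn_leq it.
rewrite /olradre; congr olr_pred.
rewrite -{1}rt0 index_map ?index_enum_ord; last exact: can_inj rK.
rewrite -map_take; apply/eq_in_map => i; rewrite mem_take_enum => it.
by rewrite ffunE it.
Qed.

Lemma measurable_olradre u :
  measurable_fun setT (fun w => olradre m lam (rho w) (observation^~ w) u).
Proof.
under eq_fun do rewrite olradre_visit_sum.
apply: measurable_fun_fsum => z _; apply: measurable_funM.
  by apply: measurable_indic; exact: measurable_path_event.
by apply: measurable_olr_pred => // v _; exact: measurable_obs.
Qed.

Hypothesis non_anticipating :
  forall (t : 'I_N) (s : L) (r : 'I_N -> L) (B : 'I_N -> set R) (Be : set R),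
     (forall i, measurable (B i)) -> measurable Be ->
     let E := [set w | rho w t = s /\
                 (forall i : 'I_N, (i <= t)%N -> rho w i = r i) /\
                 (forall i : 'I_N, (i < t)%N ->
                    theta_star (rho w i) + sigma * eps (rho w i) w \in B i)] in
     P (E `&` (eps s @^-1` Be)) = (P E * P (eps s @^-1` Be))%E.
Hypothesis ieps : forall s, P.-integrable setT (EFin \o eps s).
Hypothesis eps0 : forall s, (\int[P]_w (eps s w)%:E = 0)%E.

Section OnePath.
Variables (t : 'I_N) (r : 'I_N -> L) (u : L).
Hypothesis rt : r t = u.

(** The event appearing in the non-anticipation hypothesis, for one fixed path. *)
Definition cyl (B : 'I_N -> set R) : set Om :=
  [set w | rho w t = u /\
                 (forall i : 'I_N, (i <= t)%N -> rho w i = r i) /\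
                 (forall i : 'I_N, (i < t)%N ->
                    theta_star (rho w i) + sigma * eps (rho w i) w \in B i)].

(** The full set is added by hand: the largest cylinder is only the path event, and the pi-system
    has to exhaust the space. *)
Definition cyls : set (set Om) := [set A | A = setT \/
  exists2 B, (forall i, measurable (B i)) & A = cyl B].

Lemma cylE B : cyl B = path_event t r `&`
  \bigcap_(i in [set i : 'I_N | (i < t)%N]) (observation (r i) @^-1` B i).
Proof.
apply/seteqP; split => w /=.
  move=> [_ [h1 h2]]; split=> // i /= it; have := h2 i it.
  by rewrite inE h1 // ltnW.
move=> [h1 h2]; split; first by rewrite h1.
by split=> // i it; rewrite inE h1 ?(ltnW it) //; exact: h2.
Qed.

Lemma measurable_cyls A : cyls A -> measurable A.
Proof.
move=> [->|[B mB ->]]; first exact: measurableT.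
rewrite cylE; apply: measurableI; first exact: measurable_path_event.
apply: fin_bigcap_measurable => [|i _]; first exact: finite_finset.
by rewrite -[X in measurable X]setTI; apply: measurable_obs.
Qed.

Lemma setI_closed_cyls : setI_closed cyls.
Proof.
move=> A1 A2 [->|[B1 mB1 ->]] [->|[B2 mB2 ->]]; rewrite ?setTI ?setIT.
- by left.
- by right; exists B2.
- by right; exists B1.
right; exists (fun i => B1 i `&` B2 i); first by move=> i; exact: measurableI.
rewrite !cylE; apply/seteqP; split => w /=.
  by move=> [[h1 h2] [_ h3]]; split=> // i it; split; [exact: h2|exact: h3].
move=> [h1 h2]; split; split=> // i it; by have [] := h2 i it.
Qed.

Lemma path_event_cyl : path_event t r = cyl (fun=> setT).
Proof. by rewrite cylE; apply/seteqP; split => w //= [? _]. Qed.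

Lemma one_path_orth :
  (\int[P]_w (\1_(path_event t r) w * olr_pred m lam (observation^~ w) (prefix_seq t r) u
      * eps u w)%:E = 0)%E.
Proof.
(* Off the path event the observations need not be measurable for the sigma-algebra of [cyls].
   Killing them there restores measurability and leaves the product with the indicator unchanged. *)
pose Y v w : R := \1_(path_event t r) w * observation v w.
pose g w := \1_(path_event t r) w * olr_pred m lam (Y^~ w) (prefix_seq t r) u.
have gE w : \1_(path_event t r) w * olr_pred m lam (observation^~ w) (prefix_seq t r) u = g w.
  rewrite /g indicE; case: (boolP (w \in _)) => wE; last by rewrite !mul0r.
  congr (_ * olr_pred _ _ _ _ _); apply/funext => v.
  by rewrite /Y indicE wE mul1r.
under eq_integral do rewrite gE.
have Gev : cyls (path_event t r) by right; exists (fun=> setT) => //; exact: path_event_cyl.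
have mev : measurable (path_event t r : set (g_sigma_algebraType cyls)).
  exact: sub_sigma_algebra.
apply: (@pi_indep_integral_mul0 _ _ _ P _ (meps u) (ieps u) (eps0 u) cyls g lam).
- exact: setI_closed_cyls.
- by left.
- exact: measurable_cyls.
- move=> A B [->|[C mC ->]] mB; last exact: (non_anticipating t u r mC mB).
  by rewrite setTI [P setT]probability_setT mul1e.
- apply: measurable_funM; first exact: measurable_indic.
  apply: measurable_olr_pred => // v /mapP[i]; rewrite mem_take_enum => it ->.
  move=> _ B mB; rewrite setTI.
  (* Off the path event [Y] is 0, so the complement of that event enters the preimage exactly when 0
     is in B. *)
  have -> : Y (r i) @^-1` B =
     cyl (fun j => if j == i then B else setT) `|`
     (~` path_event t r `&` [set w | B 0]).
    rewrite cylE; apply/seteqP; split => w; rewrite /Y /= indicE.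
      have [wE|wE] := pselect (path_event t r w).
        by rewrite mem_set // mul1r => By; left; split=> // j jt /=; case: eqP => [->|].
      by rewrite memNset // mul0r => B0; right.
    move=> [[wE]|[wE B0]]; last by rewrite memNset // mul0r.
    by rewrite mem_set // mul1r => /(_ i it) /=; rewrite eqxx.
  apply: measurableU.
    apply: sub_sigma_algebra; right.
    by exists (fun j => if j == i then B else setT) => // j; case: eqP.
  apply: measurableI; first exact: measurableC.
  have [B0|B0] := pselect (B 0).
    by rewrite (_ : [set w | B 0] = setT) //; apply/seteqP; split.
  by rewrite (_ : [set w | B 0] = set0) //; apply/seteqP; split.
move=> w; rewrite /g indicE; case: (w \in _); last by rewrite mul0r normr0 ltW.
by rewrite mul1r ler_norml olr_pred_itv.
Qed.
End OnePath.

Lemma olradre_itv w u : - lam <= olradre m lam (rho w) (observation^~ w) u <= lam.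
Proof. exact: olr_pred_itv. Qed.

Lemma integrable_bounded_noise (f : Om -> R) (c : R) u : measurable_fun setT f ->
  (forall w, `|f w| <= c) -> P.-integrable setT (fun w => (f w * eps u w)%:E).
Proof.
move=> mf fc.
have i2 : P.-integrable setT (fun w => (c%:E * (eps u w)%:E)%E).
  by apply: integrableZl => //; exact: ieps.
apply: le_integrable i2 => //.
  by apply/measurable_EFinP; apply: measurable_funM.
move=> w _; rewrite /= lee_fin !normrM ler_wpM2r //.
by rewrite (le_trans (fc _)) // ler_norm.
Qed.

Lemma olradre_orth u :
  (\int[P]_w (olradre m lam (rho w) (observation^~ w) u * eps u w)%:E = 0)%E.
Proof.
under eq_integral do rewrite olradre_visit_sum mulr_suml -sumEFin.
rewrite integral_sum //; last first.
  move=> z; apply: (integrable_bounded_noise (c := lam)).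
    apply: measurable_funM.
      by apply: measurable_indic; exact: measurable_path_event.
    by apply: measurable_olr_pred => // v _; exact: measurable_obs.
  move=> w; rewrite indicE; case: (w \in _); last by rewrite mul0r normr0 ltW.
  by rewrite mul1r ler_norml olr_pred_itv.
rewrite big1 // => -[t r] /= /forallP /= cr; apply: one_path_orth.
by have := cr t; rewrite leqnn => /eqP.
Qed.
End Orthogonality.

(** * Risk bound *)

Section Main.
Variables (R : realType) (d k m : nat) (lam : R).
Local Notation n := (2 ^ k)%N.
Local Notation L := (lattice d n).
Local Notation N := (n ^ d)%N.
Local Notation p := #|monos d m|.

Lemma olradre_card1 (r : 'I_N -> L) (y : L -> R) u : 0 < lam -> N = 1%N -> bijective r ->
  olradre m lam r y u = 0.
Proof.
move=> l0 N1 [r' rK r'K].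
rewrite /olradre; set s := map _ _.
have us : u \in s by apply/mapP; exists (r' u); rewrite ?mem_enum ?r'K.
have -> : index u s = 0%N.
  have : (index u s < N)%N by rewrite -[X in (_ < X)%N](size_enum_ord N) -(size_map r) index_mem.
  by move=> /leq_trans /(_ (eq_leq N1)); rewrite ltnS leqn0 => /eqP.
rewrite take0 /olr_pred /= big1 // => S _.
have -> : expert_pred m y [::] S u = 0.
  rewrite expert_pred_vaw /vaw_pred /bvec big1; last by move=> v; rewrite !inE.
  by rewrite mulmx0 /dotc mulmx0 mxE.
by rewrite trunc_id ?mulr0 // normr0 ltW.
Qed.

Context (dO : measure_display) (Om : measurableType dO) (P : probability Om R)
  (sigma : R) (theta_star : L -> R) (eps : L -> Om -> R) (rho : Om -> 'I_N -> L).
Local Notation obs := (observation sigma theta_star eps).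
Local Notation est w u := (olradre m lam (rho w) (obs^~ w) u).
Hypothesis lam1 : 1 < lam.
Hypothesis sigma0 : 0 < sigma.
Hypothesis meps : forall s, measurable_fun setT (eps s).
Hypothesis teps : forall s (x : R), 0 <= x ->
     (P [set w | (x <= eps s w)%R] <= (2 * expR (- (x ^+ 2) / 2))%:E)%E /\
     (P [set w | (eps s w <= - x)%R] <= (2 * expR (- (x ^+ 2) / 2))%:E)%E.
Hypothesis eps0 : forall s, (\int[P]_w (eps s w)%:E = 0)%E.
Hypothesis rho_bij : forall w, bijective (rho w).
Hypothesis mrho : forall t s, measurable [set w | rho w t = s].
Hypothesis non_anticipating :
  forall (t : 'I_N) (s : L) (r : 'I_N -> L) (B : 'I_N -> set R) (Be : set R),
     (forall i, measurable (B i)) -> measurable Be ->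
     let E := [set w | rho w t = s /\
                 (forall i : 'I_N, (i <= t)%N -> rho w i = r i) /\
                 (forall i : 'I_N, (i < t)%N ->
                    theta_star (rho w i) + sigma * eps (rho w i) w \in B i)] in
     P (E `&` (eps s @^-1` Be)) = (P E * P (eps s @^-1` Be))%E.
Variables (T : {set L}) (Pt : {set {set L}}) (theta : L -> R)
         (beta : {set L} -> {ffun 'I_d -> 'I_m.+1} -> R).
Hypothesis PtT : rect_partition Pt T.
Hypothesis thetaE : forall S, S \in Pt -> forall u, u \in S ->
     theta u = \sum_(mm in monos d m)
                 beta S mm * \prod_(i < d) (lcoord u i)%:R ^+ mm i.
Local Notation sinf := (s_m_inf Pt beta).

Let lam0 : 0 < lam. Proof. exact: lt_trans lam1. Qed.

Lemma theta_bound u : u \in T -> `|theta u| <= p%:R * sinf.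
Proof.
case/andP: PtT => /and3P[/eqP <- _ _] _ /bigcupP[S SP uS].
by rewrite (thetaE SP uS); exact: theta_le.
Qed.

Variable K : R.
Hypothesis K2 : 2 <= K.
Hypothesis obsK : forall u w, `|eps u w| < K -> `|obs u w| <= lam.
Hypothesis star_lam : forall u, `|theta_star u| <= lam.

Local Notation tails w := (\sum_(u : L) tail_part (eps u) K w).
Let regret := #|Pt|%:R * (((2 * k.+1) ^ d)%N%:R * reg_const d k m lam sinf).
(** The first summand covers the trivial error 4 lam^2 N when [tails] >= K. The second offsets a
    negative cross term, using that the sum of all |eps_u| is at most N K + [tails], hence at most
    (1 + N) [tails]. *)
Let tail_coef := 4 * lam ^+ 2 * N%:R / K + 2 * sigma * (lam + p%:R * sinf) * (1 + N%:R).

Lemma card_lattice : #|{: L}| = N.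
Proof. by rewrite card_ffun !card_ord. Qed.

(** On the good event, subtracting the two expanded squares gives an exact identity and the
    deterministic regret applies; otherwise some |eps_v| >= K and the tails alone suffice. *)
Lemma risk_pointwise w :
  \sum_(u in T) (est w u - theta_star u) ^+ 2 <=
  \sum_(u in T) (theta_star u - theta u) ^+ 2 + regret +
  (2 * sigma * \sum_(u in T) (est w u - theta u) * eps u w + tail_coef * tails w).
Proof.
have s0 : 0 <= sinf := s_m_inf_ge0 _ _.
have K0 : 0 < K by exact: lt_le_trans K2.
have tl0 : 0 <= tails w by apply: sumr_ge0 => u _; exact: tail_part_ge0.
have c0 : 0 <= tail_coef.
  rewrite addr_ge0 //.
    by rewrite divr_ge0 ?mulr_ge0 ?sqr_ge0 // ltW.
  rewrite !mulr_ge0 // ?addr_ge0 ?mulr_ge0 //; by rewrite ltW.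
have r0 : 0 <= regret by rewrite !mulr_ge0 // reg_const_ge0.
have [good|/existsNP[v /negP]] := pselect (forall u, `|obs u w| <= lam).
  have := partition_regret lam0 good (rho_bij w) PtT thetaE; rewrite -/regret => H.
  have E : \sum_(u in T) (est w u - theta_star u) ^+ 2 =
     \sum_(u in T) (obs u w - est w u) ^+ 2 - \sum_(u in T) (obs u w - theta u) ^+ 2
     + \sum_(u in T) (theta_star u - theta u) ^+ 2
     + 2 * sigma * \sum_(u in T) (est w u - theta u) * eps u w.
    rewrite mulr_sumr -sumrB -!big_split /=; apply: eq_bigr => u _.
    rewrite /observation; ring.
  have := mulr_ge0 c0 tl0; rewrite E; lra.
rewrite -ltNge => bad.
have Kv : K <= `|eps v w|.
  by rewrite leNgt; apply/negP => /obsK; rewrite leNgt bad.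
have KM : K <= tails w.
  rewrite (bigD1 v) //= ler_wpDr //; last first.
    by rewrite /tail_part indicE mem_set // mulr1.
  by apply: sumr_ge0 => u _; exact: tail_part_ge0.
have tT (F : L -> R) : (forall u, 0 <= F u) -> \sum_(u in T) F u <= \sum_u F u.
  move=> F0; rewrite [leRHS](bigID (mem T)) /= lerDl.
  by apply: sumr_ge0.
have A1 : \sum_(u in T) (est w u - theta_star u) ^+ 2 <= 4 * lam ^+ 2 * N%:R.
  apply: (@le_trans _ _ (\sum_(u in T) 4 * lam ^+ 2)).
    apply: ler_sum => u _.
    have := olradre_itv m lam0 sigma theta_star eps rho w u.
    have := star_lam u; rewrite ler_norml => /andP[a1 a2] /andP[b1 b2]; nra.
  apply: (le_trans (tT (fun=> 4 * lam ^+ 2) _)).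
    by move=> _; rewrite mulr_ge0 ?sqr_ge0.
  by rewrite sumr_const card_lattice mulr_natr.
have A2 : 4 * lam ^+ 2 * N%:R <= 4 * lam ^+ 2 * N%:R / K * tails w.
  rewrite -[leLHS](divfK (lt0r_neq0 K0)) ler_wpM2l //.
  by rewrite divr_ge0 ?mulr_ge0 ?sqr_ge0 // ltW.
have eK u : `|eps u w| <= K + tail_part (eps u) K w.
  rewrite /tail_part indicE; have [h|h] := leP K `|eps u w|.
    by rewrite mem_set // mulr1 lerDr ltW.
  by rewrite memNset ?mulr0 ?addr0 ?ltW //=; rewrite leNgt h.
have A3 : - \sum_(u in T) (est w u - theta u) * eps u w <=
   (lam + p%:R * sinf) * ((1 + N%:R) * tails w).
  rewrite -sumrN.
  apply: (@le_trans _ _ (\sum_(u in T) (lam + p%:R * sinf) * `|eps u w|)).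
    apply: ler_sum => u uT; rewrite (le_trans (ler_norm _)) // normrN normrM.
    rewrite ler_wpM2r // (le_trans (ler_normB _ _)) // lerD ?theta_bound //.
    by rewrite ler_norml; exact: olradre_itv.
  rewrite -mulr_sumr ler_wpM2l ?addr_ge0 ?mulr_ge0 ?(ltW lam0) //.
  apply: (le_trans (tT (fun u => `|eps u w|) _)) => //.
  apply: (@le_trans _ _ (\sum_u (K + tail_part (eps u) K w))).
    by apply: ler_sum => u _; exact: eK.
  rewrite big_split /= sumr_const card_lattice mulrDl mul1r addrC lerD2l.
  by rewrite -[leLHS]mulr_natl ler_wpM2l.
have A4 : - (2 * sigma * \sum_(u in T) (est w u - theta u) * eps u w) <=
   2 * sigma * (lam + p%:R * sinf) * (1 + N%:R) * tails w.
  by rewrite -mulrN -!mulrA ler_wpM2l // ler_wpM2l ?(ltW sigma0).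
have S0 : 0 <= \sum_(u in T) (theta_star u - theta u) ^+ 2.
  by apply: sumr_ge0 => u _; rewrite sqr_ge0.
rewrite /tail_coef mulrDl; lra.
Qed.

Let ieps s : P.-integrable setT (EFin \o eps s).
Proof. by apply: integrable_noise => //; exact: teps. Qed.

Lemma integral_cross u :
  (\int[P]_w ((est w u - theta u) * eps u w)%:E = 0)%E.
Proof.
under eq_integral do rewrite mulrBl EFinB.
rewrite integralB //=; last first.
- by apply: (integrable_bounded_noise meps ieps (c := `|theta u|)).
- apply: (integrable_bounded_noise meps ieps (c := lam)); first exact: measurable_olradre.
  by move=> w; rewrite ler_norml; exact: olradre_itv.
rewrite olradre_orth //; under eq_integral do rewrite EFinM.
rewrite integralZl //; last exact: ieps.
by rewrite eps0 mule0 sube0.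
Qed.

Lemma risk_le :
  (\int[P]_w (\sum_(u in T) (est w u - theta_star u) ^+ 2)%:E <=
   (\sum_(u in T) (theta_star u - theta u) ^+ 2 + regret
     + tail_coef * (N%:R * (16 * K * expR (- K ^+ 2 / 2))))%:E)%E.
Proof.
have mest u : measurable_fun setT (fun w => est w u) by exact: measurable_olradre.
pose A w := ((2 * sigma)%:E * \sum_(u in T) ((est w u - theta u) * eps u w)%:E)%E.
pose B w := (tail_coef%:E * \sum_(u : L) (tail_part (eps u) K w)%:E)%E.
pose c0 := \sum_(u in T) (theta_star u - theta u) ^+ 2 + regret.
have icr u : P.-integrable setT (fun w => ((est w u - theta u) * eps u w)%:E).
  apply: (integrable_bounded_noise meps ieps (c := lam + `|theta u|)).
    by apply: measurable_funB.
  move=> w; rewrite (le_trans (ler_normB _ _)) // lerD2r ler_norml.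
  exact: olradre_itv.
have it u : P.-integrable setT (fun w => (tail_part (eps u) K w)%:E).
  by apply: integrable_tail_part => //; exact: teps.
have isA : P.-integrable setT (fun w => \sum_(u in T) ((est w u - theta u) * eps u w)%:E)%E.
  by apply: integrable_sum.
have isB : P.-integrable setT (fun w => \sum_(u : L) (tail_part (eps u) K w)%:E)%E.
  by apply: integrable_sum.
have iA : P.-integrable setT A by apply: integrableZl.
have iB : P.-integrable setT B by apply: integrableZl.
have iAB : P.-integrable setT (fun w => (A w + B w)%E) by apply: integrableD.
have ic : P.-integrable setT (fun w => c0%:E) by apply: finite_measure_integrable_cst.
have iW : P.-integrable setT (fun w => (c0%:E + (A w + B w))%E) by apply: integrableD.
(* [A] is the cross term, which integrates to 0, and [B] the tail penalty. *)
apply: (@le_trans _ _ (\int[P]_w (c0%:E + (A w + B w)))%E).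
  apply: ge0_le_integral => //.
  - by move=> w _; rewrite lee_fin sumr_ge0 // => u _; rewrite sqr_ge0.
  - apply/measurable_EFinP; apply: measurable_fun_fsum => u _.
    by apply: measurable_funX; apply: measurable_funB.
  - by case/integrableP: iW.
  - move=> w _; rewrite /A /B !sumEFin -!EFinM -!EFinD lee_fin.
    exact: risk_pointwise.
rewrite integralD // integralD //.
rewrite integralZl // integralZl // !integral_sum //.
rewrite (eq_bigr (fun=> 0%E)); last by move=> u _; exact: integral_cross.
rewrite big1 // mule0 add0e integral_cst // [X in (c0%:E * X)%E](probability_setT P) mule1.
rewrite [leRHS]EFinD -/c0 leeD2l // EFinM.
have c1 : 0 <= tail_coef.
  have s0 : 0 <= sinf := s_m_inf_ge0 _ _.
  have K0 : 0 < K by exact: lt_le_trans K2.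
  rewrite addr_ge0 //.
    by rewrite divr_ge0 ?mulr_ge0 ?sqr_ge0 // ltW.
  rewrite !mulr_ge0 // ?addr_ge0 ?mulr_ge0 //; by rewrite ltW.
apply: lee_wpmul2l; first by rewrite lee_fin.
rewrite (_ : N%:R * _ = \sum_(u : L) 16 * K * expR (- K ^+ 2 / 2)); last first.
  by rewrite sumr_const card_lattice mulr_natl.
rewrite -sumEFin; apply: lee_sum => u _.
by apply: integral_tail_part => //; exact: teps.
Qed.

End Main.

(** * Numerical constants and the final assembly *)

Lemma ln2_ge_half (R : realType) : 2^-1 <= ln 2 :> R.
Proof.
have : ln (1 + - 2^-1) <= - 2^-1 :> R by apply: le_ln1Dx; lra.
rewrite (_ : 1 + - 2^-1 = 2^-1 :> R); last by lra.
by rewrite lnV ?posrE // lerN2.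
Qed.

Lemma det_const_ge0 (R : realType) d m : 0 <= det_const R d m.
Proof.
have l2 := ln2_gt0 R.
rewrite mulr_ge0 ?exprn_ge0 ?divr_ge0 ?(ltW l2) // !addr_ge0 // divr_ge0 ?(ltW l2) //.
by rewrite !addr_ge0 // ln_ge0 // ler1n fact_gt0.
Qed.

Lemma le_sup_norm (R : realType) d n (th : lattice d n -> R) u : `|th u| <= sup_norm th.
Proof. exact: (bigmax_sup u). Qed.

(* The level K = 9 sqrt(ln N) makes the union bound over N sites negligible. *)
Lemma tail_level (R : realType) (N : nat) : (1 < N)%N ->
  let K := 9 * Num.sqrt (ln N%:R) : R in
  2 <= K /\ N%:R ^+ 2 * expR (- K ^+ 2 / 2) <= 1.
Proof.
move=> N1 K; have N0 : 0 < N%:R :> R by rewrite ltr0n (ltn_trans _ N1).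
have lN : ln 2 <= ln N%:R :> R by rewrite ler_ln ?posrE // ler_nat.
have l2 := ln2_ge_half R; have lN0 : 0 <= ln N%:R :> R by lra.
have K0 : 0 <= K by rewrite mulr_ge0 ?sqrtr_ge0.
have KE : K ^+ 2 = 81 * ln N%:R by rewrite exprMn sqr_sqrtr // -natrX.
split; first by nra.
rewrite -{1}(lnK N0) -expRM_natl -expRD -[leRHS]expR0 ler_expR KE; lra.
Qed.

(** Here q stands for exp(-K^2/2). In the first product K cancels; in the second it joins sigma, and
    sigma K <= lam. Each contributes at most 64 (1 + p)(lam + s)^2. *)
Lemma bad_event_le (R : realType) (N : nat) (lam sigma K s q : R) (p : nat) :
  (1 <= N)%N -> 0 < lam -> 0 < K -> 0 < sigma -> 0 <= s -> 0 <= q ->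
  sigma * K <= lam -> N%:R ^+ 2 * q <= 1 ->
  (4 * lam ^+ 2 * N%:R / K + 2 * sigma * (lam + p%:R * s) * (1 + N%:R))
    * (N%:R * (16 * K * q)) <= 128 * (1 + p%:R) * (lam + s) ^+ 2.
Proof.
move=> N1 l0 K0 sg0 s0 q0 sK Nq.
have E : (4 * lam ^+ 2 * N%:R / K + 2 * sigma * (lam + p%:R * s) * (1 + N%:R))
    * (N%:R * (16 * K * q)) = 64 * lam ^+ 2 * (N%:R ^+ 2 * q)
      + 32 * (lam + p%:R * s) * ((sigma * K) * ((1 + N%:R) * N%:R * q)).
  by field; rewrite lt0r_neq0.
have p0 : 0 <= p%:R :> R by [].
have ps : 0 <= p%:R * s by rewrite mulr_ge0.
have pl : 0 <= p%:R * lam by rewrite mulr_ge0 // ltW.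
have NN : (1 + N%:R) * N%:R * q <= 2.
  have : (1 + N%:R) * N%:R * q <= (2 * N%:R) * N%:R * q.
    rewrite ler_wpM2r // ler_wpM2r // mulr_natl mulr2n lerD2r ler1n //.
  have : N%:R ^+ 2 * q = N%:R * N%:R * q by rewrite expr2.
  rewrite -!mulrA; lra.
have A : (sigma * K) * ((1 + N%:R) * N%:R * q) <= lam * 2.
  by apply: ler_pM => //; rewrite !mulr_ge0 // ?addr_ge0 // ltW.
have B : lam + p%:R * s <= (1 + p%:R) * (lam + s).
  by rewrite mulrDl mul1r mulrDr; lra.
have C : 64 * lam ^+ 2 * (N%:R ^+ 2 * q) <= 64 * lam ^+ 2.
  by rewrite ler_piMr // mulr_ge0 ?sqr_ge0.
have ls : 0 <= lam + s by rewrite addr_ge0 // ltW.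
have D : 32 * (lam + p%:R * s) * ((sigma * K) * ((1 + N%:R) * N%:R * q)) <=
   32 * ((1 + p%:R) * (lam + s)) * ((lam + s) * 2).
  apply: ler_pM => //.
  - by rewrite mulr_ge0 // addr_ge0 // ltW.
  - by rewrite !mulr_ge0 // ?addr_ge0 // ltW.
  - by rewrite ler_wpM2l.
  - by rewrite (le_trans A) // ler_wpM2r // lerDl.
have F : lam ^+ 2 <= (lam + s) ^+ 2 by rewrite ler_sqr ?nnegrE ?lerDl ?(ltW l0).
have G : (lam + s) ^+ 2 <= (1 + p%:R) * (lam + s) ^+ 2.
  by rewrite ler_peMl ?sqr_ge0 // lerDl.
rewrite E (le_trans (lerD C D)) //.
have -> : 32 * ((1 + p%:R) * (lam + s)) * ((lam + s) * 2) = 64 * ((1 + p%:R) * (lam + s) ^+ 2).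
  by ring.
lra.
Qed.

Theorem mainTheorem9 (R : realType) :
  exists C : R, forall (m d : nat), exists Cmd : R, 1 < Cmd /\
  forall (k : nat) (T : {set lattice d (2 ^ k)})
    (dO : measure_display) (Omega : measurableType dO) (P : probability Omega R)
    (sigma : R) (theta_star : lattice d (2 ^ k) -> R)
    (eps : lattice d (2 ^ k) -> Omega -> R)
    (rho : Omega -> 'I_((2 ^ k) ^ d) -> lattice d (2 ^ k))
    (lam : R),
  (0 < #|T|)%N ->
  0 < sigma ->
  (* noise: measurable, mutually independent, mean zero, sub-Gaussian tails *)
  (forall s, measurable_fun setT (eps s)) ->
  (forall B : lattice d (2 ^ k) -> set R, (forall s, measurable (B s)) ->
     P (\bigcap_s (eps s @^-1` B s)) = (\prod_s P (eps s @^-1` B s))%E) ->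
  (forall s, (\int[P]_w (eps s w)%:E = 0)%E) ->
  (forall s (x : R), 0 <= x ->
     (P [set w | (x <= eps s w)%R] <= (2 * expR (- (x ^+ 2) / 2))%:E)%E /\
     (P [set w | (eps s w <= - x)%R] <= (2 * expR (- (x ^+ 2) / 2))%:E)%E) ->
  (* rho: a random bijection [N] -> L_{d,n} *)
  (forall w, bijective (rho w)) ->
  (forall t s, measurable [set w | rho w t = s]) ->
  (* rho is non-anticipating (checked on the generating pi-system of
     sigma(rho(1..t), y_{rho(1)},...,y_{rho(t-1)})) *)
  (forall (t : 'I_((2 ^ k) ^ d)) (s : lattice d (2 ^ k))
          (r : 'I_((2 ^ k) ^ d) -> lattice d (2 ^ k))
          (B : 'I_((2 ^ k) ^ d) -> set R) (Be : set R),
     (forall i, measurable (B i)) -> measurable Be ->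
     let E := [set w | rho w t = s /\
                 (forall i : 'I_((2 ^ k) ^ d), (i <= t)%N -> rho w i = r i) /\
                 (forall i : 'I_((2 ^ k) ^ d), (i < t)%N ->
                    theta_star (rho w i) + sigma * eps (rho w i) w \in B i)] in
     P (E `&` (eps s @^-1` Be)) = (P E * P (eps s @^-1` Be))%E) ->
  (* truncation level *)
  1 < lam ->
  C * Num.max (sigma * Num.sqrt (ln ((2 ^ k) ^ d)%:R)) (sup_norm theta_star) <= lam ->
  forall (Pt : {set {set lattice d (2 ^ k)}}) (theta : lattice d (2 ^ k) -> R)
         (beta : {set lattice d (2 ^ k)} -> {ffun 'I_d -> 'I_m.+1} -> R),
  rect_partition Pt T ->
  (forall S, S \in Pt -> forall u, u \in S ->
     theta u = \sum_(mm in monos d m)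
                 beta S mm * \prod_(i < d) (lcoord u i)%:R ^+ mm i) ->
  ((#|T|%:R)^-1%:E *
     \int[P]_w (\sum_(u in T)
        (olradre m lam (rho w)
           (fun v => theta_star v + sigma * eps v w) u - theta_star u) ^+ 2)%:E
   <= ((#|T|%:R)^-1 * \sum_(u in T) (theta_star u - theta u) ^+ 2
       + Cmd * (lam + s_m_inf Pt beta) ^+ 2 * (#|Pt|%:R / #|T|%:R)
             * ln (expR 1 * (2 ^ k)%:R) ^+ d
             * ln ((2 ^ d * (2 ^ k) ^ d)%N%:R)
       + (sigma ^+ 2 + lam ^+ 2) / (#|T|%:R ^+ 2))%:E)%E.
Proof.
exists 10 => m d; set p := #|monos d m|.
have ln20 := ln2_gt0 R; have dc0 := det_const_ge0 R d m.
have bc0 : 0 <= 128 * (1 + p%:R) / ln 2 :> R.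
  by rewrite divr_ge0 ?mulr_ge0 ?addr_ge0 // ltW.
(* The summands pay for the regret, for the large-noise event (ln 2 is absorbed by ln(2^d N)), and
   for the requirement of exceeding 1. *)
exists (det_const R d m + 128 * (1 + p%:R) / ln 2 + 2); split; first by lra.
move=> k T dO Omega P sigma theta_star eps rho lam T0 sigma0 meps _ eps0 teps rho_bij
  mrho na lam1 lamC Pt theta beta PtT thE.
have lam0 : 0 < lam by exact: lt_trans lam1.
have s0 : 0 <= s_m_inf Pt beta := s_m_inf_ge0 _ _.
have T0' : 0 < #|T|%:R :> R by rewrite ltr0n.
have starC u : 10 * `|theta_star u| <= lam.
  apply: le_trans lamC; rewrite ler_wpM2l // le_max le_sup_norm orbT //.
set l := ln ((2 ^ d * (2 ^ k) ^ d)%N%:R); set e := ln (expR 1 * (2 ^ k)%:R).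
have e1 : 1 <= e ^+ d by rewrite exprn_ege1 // ln_en_ge1.
have ed0 : 0 <= e ^+ d := le_trans ler01 e1.
have l0 : 0 <= l by rewrite ln_ge0 // ler1n muln_gt0 !expn_gt0.
set A := (lam + s_m_inf Pt beta) ^+ 2.
have A0 : 0 <= A by rewrite sqr_ge0.
set Cmd := det_const R d m + _ + 2; have C0 : 0 <= Cmd by rewrite /Cmd; lra.
have Kx0 : 0 <= Cmd * A * (#|Pt|%:R / #|T|%:R) * e ^+ d * l.
  have PT0 : 0 <= #|Pt|%:R / #|T|%:R :> R by rewrite divr_ge0.
  by do 4 (apply: mulr_ge0 => //).
set S0 := \sum_(u in T) (theta_star u - theta u) ^+ 2.
have S00 : 0 <= S0 by apply: sumr_ge0 => u _; rewrite sqr_ge0.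
(* For N = 1 the level K would be 0, and for d = 0 even ln(2^d N) vanishes. The error is then
   theta*^2 <= lam^2 at a single site. *)
have [N1|N1] := eqVneq ((2 ^ k) ^ d)%N 1%N.
  have cT : #|T| = 1%N.
    apply/eqP; rewrite eqn_leq T0 andbT (leq_trans (max_card _)) //.
    by rewrite card_lattice (eq_leq N1).
  under eq_integral do under eq_bigr do rewrite olradre_card1 // sub0r sqrrN.
  rewrite integral_cst // [X in (_ * (_ * X))%E](probability_setT P) mule1 -EFinM lee_fin.
  rewrite cT !invr1 !mul1r in Kx0 *.
  have : \sum_(u in T) theta_star u ^+ 2 <= lam ^+ 2.
    apply: (@le_trans _ _ (\sum_(u in T) lam ^+ 2)); last by rewrite sumr_const cT.
    apply: ler_sum => u _; rewrite -[leLHS]real_normK ?num_real //.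
    by rewrite ler_sqr ?nnegrE ?(ltW lam0) //; have := starC u; have := normr_ge0 (theta_star u); lra.
  have : 0 <= sigma ^+ 2 by rewrite sqr_ge0.
  rewrite expr1n invr1 mulr1; lra.
have {}N1 : (1 < (2 ^ k) ^ d)%N by rewrite ltn_neqAle eq_sym N1 !expn_gt0.
have d0 : (0 < d)%N by case: (d) N1.
set N := ((2 ^ k) ^ d)%N in N1 *; set K := 9 * Num.sqrt (ln N%:R) : R.
have [K2 NK] := tail_level R N1; rewrite -/K in K2 NK.
have K0 : 0 < K by exact: lt_le_trans K2.
have sigC : 10 * (sigma * Num.sqrt (ln N%:R)) <= lam.
  by apply: le_trans lamC; rewrite ler_wpM2l // le_max lexx.
have sigK : 10 * (sigma * K) <= 9 * lam by rewrite /K; lra.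
have obsK u w : `|eps u w| < K -> `|observation sigma theta_star eps u w| <= lam.
  move=> eK; rewrite (le_trans (ler_normD _ _)) // normrM gtr0_norm //.
  have : sigma * `|eps u w| <= sigma * K by rewrite ler_wpM2l // ltW.
  have := starC u; lra.
have star_lam u : `|theta_star u| <= lam.
  by have := starC u; have := normr_ge0 (theta_star u); lra.
have := @risk_le R d k m lam dO Omega P sigma theta_star eps rho lam1 sigma0 meps teps eps0
  rho_bij mrho na T Pt theta beta PtT thE K K2 obsK star_lam.
set I := (\int[P]_w _)%E => HI.
(* T is nonempty, so the partition has a cell and the tail cost, which carries no factor |P|, fits
   into the complexity term. *)
have Pt1 : 1 <= #|Pt|%:R :> R.
  rewrite ler1n card_gt0; apply/negP => /eqP Pt0.
  case/andP: PtT => /and3P[/eqP cv _ _] _.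
  by move: T0; rewrite -cv Pt0 /finset.cover big_set0 cards0.
have B1 := reg_const_le k m lam0 d0 s0; rewrite -/A -/e -/l in B1.
have sK : sigma * K <= lam.
  have : 0 <= sigma * K by rewrite mulr_ge0 ?ltW.
  lra.
have B2 := bad_event_le (N := N) p (ltnW N1) lam0 K0 sigma0 s0 (expR_ge0 _) sK NK.
rewrite -/A in B2.
have l2 : ln 2 <= l.
  rewrite ler_ln ?posrE ?ltr0n ?muln_gt0 ?expn_gt0 // ler_nat.
  by rewrite -[leqLHS]mul1n leq_mul // ?expn_gt0.
have B3 : 128 * (1 + p%:R) * A <= #|Pt|%:R * (128 * (1 + p%:R) / ln 2 * A * e ^+ d * l).
  have x0 : 0 <= 128 * (1 + p%:R) / ln 2 * A by rewrite mulr_ge0.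
  apply: (@le_trans _ _ (128 * (1 + p%:R) / ln 2 * A * e ^+ d * l)); last first.
    by apply: ler_peMl => //; do 2 (apply: mulr_ge0 => //).
  apply: (@le_trans _ _ (128 * (1 + p%:R) / ln 2 * A * l)).
    rewrite [leLHS](_ : _ = 128 * (1 + p%:R) / ln 2 * A * ln 2); last by field; rewrite lt0r_neq0.
    by rewrite ler_wpM2l.
  by rewrite ler_wpM2r // ler_peMr.
have B4 : #|Pt|%:R * (((2 * k.+1) ^ d)%N%:R * reg_const d k m lam (s_m_inf Pt beta)) <=
  #|Pt|%:R * (det_const R d m * A * e ^+ d * l) by rewrite ler_wpM2l.
apply: (@le_trans _ _ ((#|T|%:R)^-1%:E * (S0 + Cmd * A * #|Pt|%:R * e ^+ d * l)%:E)%E).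
  apply: lee_wpmul2l; first by rewrite lee_fin invr_ge0 ltW.
  apply: (le_trans HI); rewrite lee_fin -addrA lerD2l.
  apply: (le_trans (lerD B4 (le_trans B2 B3))).
  rewrite -mulrDr /Cmd.
  have : 0 <= 2 * A * #|Pt|%:R * e ^+ d * l by do 4 (apply: mulr_ge0 => //).
  lra.
rewrite -EFinM lee_fin.
have : 0 <= (sigma ^+ 2 + lam ^+ 2) / (#|T|%:R ^+ 2).
  by rewrite divr_ge0 ?addr_ge0 ?sqr_ge0.
have -> : Cmd * A * (#|Pt|%:R / #|T|%:R) * e ^+ d * l =
   #|T|%:R^-1 * (Cmd * A * #|Pt|%:R * e ^+ d * l) by ring.
rewrite mulrDr; lra.
Qed.
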